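(* Let $X$ be a smooth affine algebraic variety over $\mathbb{C}$ and let $r$ be a geometric solution of the classical Yang--Baxter equation on $X$, i.e. $r\in\operatorname{Vect}(X\times X)$ satisfies $[r^{12},r^{13}]+[r^{12},r^{23}]+[r^{13},r^{23}]=0$ in $\operatorname{Vect}(X\times X\times X)$. Then $r$ admits a geometric quantization: there exists a formal diffeomorphism $R$ of $X\times X$ such that $R^{12}R^{13}R^{23}=R^{23}R^{13}R^{12}$ as formal diffeomorphisms of $X\times X\times X$, and $R=1+\hbar r+O(\hbar^2)$.
   Context: For a smooth affine algebraic variety $Y$ over $\mathbb{C}$, $\mathcal{O}(Y)$ is its ring of regular functions and $\operatorname{Vect}(Y)$ is the Lie algebra of $\mathbb{C}$-linear derivations of $\mathcal{O}(Y)$. A formal diffeomorphism of $Y$ is a ($\mathbb{C}[[\hbar]]$-linear, $\hbar$-adically continuous) ring automorphism of $\mathcal{O}(Y)[[\hbar]]$ which is the identity modulo $\hbar$; it has the form $1+\hbar v+O(\hbar^2)$ with $v\in\operatorname{Vect}(Y)$. Note $\mathcal{O}(X\times X)=\mathcal{O}(X)\otimes\mathcal{O}(X)$ and $\operatorname{Vect}(X\times X)=\operatorname{Vect}(X)\otimes\mathcal{O}(X)\,\oplus\,\mathcal{O}(X)\otimes\operatorname{Vect}(X)$. For $1\le i<j\le 3$, $r^{ij}$ (resp. $R^{ij}$) denotes the vector field (resp. formal diffeomorphism) of $X\times X\times X$ acting as $r$ (resp. $R$) in the $i$-th and $j$-th factors and trivially in the remaining factor; for example $r^{12}=r\otimes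 \mathrm{id}$ and $R^{12}=R\otimes\mathrm{id}$ (extended $\mathbb{C}[[\hbar]]$-linearly and continuously). *)

(* Defs.v *)
From HB Require Import structures.
From mathcomp Require Import all_boot all_order all_algebra.
From mathcomp Require Import boolp classical_sets functions reals.
From mathcomp Require Import complex.
From mathcomp Require Import mpoly.

Set Implicit Arguments.
Unset Strict Implicit.
Unset Printing Implicit Defensive.

Import GRing.Theory.

Local Open Scope classical_set_scope.
Local Open Scope ring_scope.

(* An affine variety is a set of points together with a bijection onto a
   Zariski-closed subset of affine space K^n. Varieties are reduced but not
   assumed to be irreducible or connected. Keeping the points abstract makes the
   points of a product literally pairs of points. *)

Definition zeros (K : closedFieldType) n (S : set {mpoly K[n]}) : set 'rV[K]_n :=
  [set v | forall p, S p -> p.@[v 0] = 0].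

Record affVariety (K : closedFieldType) := AffVariety {
  point :> Type;
  ambient : nat;
  coord : point -> 'rV[K]_ambient;
  coord_inj : injective coord;
  coord_closed : exists S : set {mpoly K[ambient]}, range coord = zeros S
}.

(* Values are taken in K^o, which is K as a module over itself. *)
Definition regular (K : closedFieldType) (Y : affVariety K) :
    {pred (Y -> K^o)} :=
  fun f => `[< exists p : {mpoly K[ambient Y]}, f = fun y => p.@[coord y 0] >].

Section RegularFunctions.
Variables (K : closedFieldType) (Y : affVariety K).

Lemma regularP (f : Y -> K^o) :
  reflect (exists p : {mpoly K[ambient Y]}, f = fun y => p.@[coord y 0])
          (f \in @regular K Y).
Proof. exact: asboolP. Qed.

Lemma regular_subring : subring_closed (@regular K Y).
Proof.
split.
- by apply/regularP; exists 1; apply/funext => y; rewrite meval1.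
- move=> f g /regularP[p ->] /regularP[q ->]; apply/regularP; exists (p - q).
  by apply/funext => y; rewrite mevalB.
- move=> f g /regularP[p ->] /regularP[q ->]; apply/regularP; exists (p * q).
  by apply/funext => y; rewrite mevalM.
Qed.

Lemma regular_scale : GRing.scaler_closed (@regular K Y).
Proof.
move=> c f /regularP[p ->]; apply/regularP; exists (c *: p).
by apply/funext => y; rewrite mevalZ.
Qed.

HB.instance Definition _ :=
  GRing.isSubringClosed.Build (Y -> K^o) (@regular K Y) regular_subring.
HB.instance Definition _ :=
  GRing.isScaleClosed.Build K (Y -> K^o) (@regular K Y) regular_scale.

Record regfun := RegFun { regfun_val :> Y -> K^o; _ : regfun_val \in @regular K Y }.

HB.instance Definition _ := [isSub of regfun for regfun_val].
HB.instance Definition _ := [Choice of regfun by <:].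
HB.instance Definition _ :=
  GRing.SubChoice_isSubComPzRing.Build _ _ regfun regular_subring.
HB.instance Definition _ := [SubZmodule_isSubLmodule of regfun by <:].

Lemma regfunP (f g : regfun) : (forall y, f y = g y) -> f = g.
Proof. by move=> fg; apply/val_inj/funext. Qed.

Lemma regfun_regular (f : regfun) : (f : Y -> K^o) \in @regular K Y.
Proof. exact: valP. Qed.

Lemma regfun_sumE (I : Type) (s : seq I) (f : I -> regfun) y :
  (\sum_(i <- s) f i) y = \sum_(i <- s) f i y.
Proof. by elim/big_rec2: _ => // i a b _ <-. Qed.

End RegularFunctions.

Notation "''O' ( Y )" := (regfun Y) (at level 8, format "''O' ( Y )").


Section Product.
Variables (K : closedFieldType) (Y Z : affVariety K).
Let m := ambient Y.
Let n := ambient Z.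

Definition prod_coord (w : Y * Z) : 'rV[K]_(m + n) :=
  row_mx (coord w.1) (coord w.2).

Lemma prod_coord_inj : injective prod_coord.
Proof.
move=> [y z] [y' z'] /eq_row_mx /= [eqy eqz].
by rewrite (coord_inj eqy) (coord_inj eqz).
Qed.

Definition lpoly (p : {mpoly K[m]}) : {mpoly K[m + n]} :=
  p \mPo [tuple 'X_(lshift n i) | i < m].
Definition rpoly (p : {mpoly K[n]}) : {mpoly K[m + n]} :=
  p \mPo [tuple 'X_(rshift m i) | i < n].

Lemma meval_lpoly p (v : 'rV[K]_(m + n)) :
  (lpoly p).@[v 0] = p.@[lsubmx v 0].
Proof.
rewrite /lpoly comp_mpoly_meval; apply: meval_eq => i.
by rewrite tnth_mktuple mevalXU mxE.
Qed.

Lemma meval_rpoly p (v : 'rV[K]_(m + n)) :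
  (rpoly p).@[v 0] = p.@[rsubmx v 0].
Proof.
rewrite /rpoly comp_mpoly_meval; apply: meval_eq => i.
by rewrite tnth_mktuple mevalXU mxE.
Qed.

Lemma prod_coord_closed :
  exists S : set {mpoly K[m + n]}, range prod_coord = zeros S.
Proof.
have [S hS] := coord_closed Y; have [T hT] := coord_closed Z.
exists ((lpoly @` S) `|` (rpoly @` T)); rewrite eqEsubset; split => v /=.
  case=> -[y z] _ <- p [] [q hq <-].
    rewrite meval_lpoly row_mxKl.
    have : zeros S (coord y) by rewrite -hS; exists y.
    exact.
  rewrite meval_rpoly row_mxKr.
  have : zeros T (coord z) by rewrite -hT; exists z.
  exact.
move=> hv.
have : zeros S (lsubmx v).
  by move=> p Sp; rewrite -meval_lpoly; apply: hv; left; exists p.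
have : zeros T (rsubmx v).
  by move=> p Tp; rewrite -meval_rpoly; apply: hv; right; exists p.
rewrite -hS -hT => -[z _ hz] [y _ hy].
by exists (y, z) => //; rewrite /prod_coord /= hy hz hsubmxK.
Qed.

Definition aprod : affVariety K :=
  @AffVariety K (Y * Z)%type (m + n) prod_coord prod_coord_inj prod_coord_closed.

End Product.

Section Morphisms.
Variable K : closedFieldType.

Definition morphism (Y Z : affVariety K) (phi : Y -> Z) : Prop :=
  forall i, (fun y => coord (phi y) 0 i) \in @regular K Y.

Lemma regular_meval (Y : affVariety K) n (p : {mpoly K[n]}) (v : 'I_n -> Y -> K^o) :
  (forall i, v i \in @regular K Y) ->
  ((fun y => p.@[fun i => v i y]) : Y -> K^o) \in @regular K Y.
Proof.
move=> hv; have q i := cid (elimT (@regularP K Y (v i)) (hv i)).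
apply/regularP; exists (p \mPo [tuple (projT1 (q i)) | i < n]).
apply/funext => y; rewrite comp_mpoly_meval; apply: meval_eq => i.
by rewrite tnth_mktuple; case: (q i) => {}q /= ->.
Qed.

Lemma morphism_comp (Y Z : affVariety K) (phi : Y -> Z) (f : 'O(Z)) :
  morphism phi -> ((fun y => f (phi y)) : Y -> K^o) \in @regular K Y.
Proof.
move=> hphi; have /regularP[p ->] := regfun_regular f.
exact: (@regular_meval _ _ p (fun i y => coord (phi y) 0 i)).
Qed.

Definition pullback (Y Z : affVariety K) (phi : Y -> Z) (hphi : morphism phi)
  (f : 'O(Z)) : 'O(Y) := RegFun (morphism_comp f hphi).

Lemma regular_coord (Y : affVariety K) i :
  ((fun y : Y => coord y 0 i) : Y -> K^o) \in @regular K Y.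
Proof. by apply/regularP; exists 'X_i; apply/funext => y; rewrite mevalXU. Qed.

Lemma eq_regular (Y : affVariety K) (f g : Y -> K^o) :
  f =1 g -> f \in @regular K Y -> g \in @regular K Y.
Proof. by move=> /funext ->. Qed.

Lemma morphism_id (Y : affVariety K) : morphism (@id Y).
Proof. exact: regular_coord. Qed.

Lemma morphism_cst (Y Z : affVariety K) (z : Z) : morphism (fun _ : Y => z).
Proof.
by move=> i; apply/regularP; exists (coord z 0 i)%:MP; apply/funext => y; rewrite mevalC.
Qed.

Lemma morphism_o (Y Z W : affVariety K) (phi : Y -> Z) (psi : Z -> W) :
  morphism phi -> morphism psi -> morphism (fun y => psi (phi y)).
Proof. by move=> hphi hpsi i; exact: (morphism_comp (RegFun (hpsi i)) hphi). Qed.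

Lemma morphism_fst (Y Z : affVariety K) : morphism (fun w : aprod Y Z => w.1).
Proof.
move=> i; apply: eq_regular (@regular_coord (aprod Y Z) (lshift _ i)) => w.
by rewrite /= row_mxEl.
Qed.

Lemma morphism_snd (Y Z : affVariety K) : morphism (fun w : aprod Y Z => w.2).
Proof.
move=> i; apply: eq_regular (@regular_coord (aprod Y Z) (rshift _ i)) => w.
by rewrite /= row_mxEr.
Qed.

Lemma morphism_pair (W Y Z : affVariety K) (phi : W -> Y) (psi : W -> Z) :
  morphism phi -> morphism psi ->
  morphism ((fun w => (phi w, psi w)) : W -> aprod Y Z).
Proof.
move=> hphi hpsi i; rewrite -(fintype.splitK i); case: (fintype.split i) => j /=.
  by apply: eq_regular (hphi j) => w; rewrite /= row_mxEl.
by apply: eq_regular (hpsi j) => w; rewrite /= row_mxEr.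
Qed.

End Morphisms.

Section Smooth.
Variables (K : closedFieldType) (Y : affVariety K).

Definition zclosed (Z : set Y) : Prop :=
  exists S : set 'O(Y), Z = [set y | forall f, S f -> f y = 0].

Definition irreducible (Z : set Y) : Prop :=
  Z !=set0 /\
  forall A B, zclosed A -> zclosed B -> Z `<=` A `|` B -> Z `<=` A \/ Z `<=` B.

Definition irreducible_chain (P : Y) (d : nat) (C : nat -> set Y) : Prop :=
  (forall i, (i <= d)%N -> [/\ zclosed (C i), irreducible (C i) & C i P]) /\
  (forall i, (i < d)%N -> C i `<` C i.+1).

(* The Krull dimension of the local ring of Y at P. *)
Definition local_dim (P : Y) (d : nat) : Prop :=
  (exists C, irreducible_chain P d C) /\
  (forall e C, irreducible_chain P e C -> (e <= d)%N).

(* The kernel of the Jacobian matrix at P of the full vanishing ideal of Y. *)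
Definition tangent_vector (P : Y) (v : 'rV[K]_(ambient Y)) : Prop :=
  forall p : {mpoly K[ambient Y]}, (forall y : Y, p.@[coord y 0] = 0) ->
    \sum_i v 0 i * (p^`M(i)).@[coord P 0] = 0.

Definition tangent_dim (P : Y) (d : nat) : Prop :=
  exists2 T : 'M[K]_(ambient Y),
    forall v : 'rV[K]_(ambient Y), (v <= T)%MS <-> tangent_vector P v
    & \rank T = d.

Definition smooth : Prop :=
  forall P : Y, exists2 d, local_dim P d & tangent_dim P d.

End Smooth.

Record vectorField (K : closedFieldType) (Y : affVariety K) := VectorField {
  vf_map :> {linear 'O(Y) -> 'O(Y)};
  vf_leibniz : forall f g, vf_map (f * g) = vf_map f * g + f * vf_map g
}.

Notation "''Vect' ( Y )" := (vectorField Y)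
  (at level 8, format "''Vect' ( Y )").

Definition lie (A : zmodType) (D E : A -> A) : A -> A :=
  fun f => D (E f) - E (D f).

Section TensId.
Variables (K : closedFieldType) (Y Z : affVariety K).

Definition slice (z : Z) (F : 'O(aprod Y Z)) : 'O(Y) :=
  pullback (morphism_pair (@morphism_id K Y) (morphism_cst Y z)) F.

Lemma slice_is_linear z : linear (slice z).
Proof. by move=> c F G; exact: regfunP. Qed.
HB.instance Definition _ z :=
  GRing.isLinear.Build K 'O(aprod Y Z) 'O(Y) _ (slice z) (slice_is_linear z).

Lemma regfun_prodP (F : 'O(aprod Y Z)) :
  exists s : seq ('O(Y) * 'O(Z)),
    forall y z, F (y, z) = \sum_(u <- s) u.1 y * u.2 z.
Proof.
have /regularP[p hp] := regfun_regular F.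
pose m1 (m : 'X_{1..ambient Y + ambient Z}) :=
  [multinom m (lshift (ambient Z) i) | i < ambient Y].
pose m2 (m : 'X_{1..ambient Y + ambient Z}) :=
  [multinom m (rshift (ambient Y) i) | i < ambient Z].
have r1 m : ((fun y => p@_m * ('X_[K, m1 m]).@[coord y 0]) : Y -> K^o)
    \in @regular K Y.
  by apply/regularP; exists (p@_m *: 'X_[m1 m]); apply/funext => y; rewrite mevalZ.
have r2 m : ((fun z => ('X_[K, m2 m]).@[coord z 0]) : Z -> K^o)
    \in @regular K Z.
  by apply/regularP; exists 'X_[m2 m].
exists [seq (RegFun (r1 m), RegFun (r2 m)) | m <- msupp p] => y z.
rewrite big_map hp /= mevalE; apply: eq_bigr => m _ /=.
rewrite -mulrA !mevalX big_split_ord /=; congr (_ * (_ * _)).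
  by apply: eq_bigr => i _; rewrite /prod_coord row_mxEl mnmE.
by apply: eq_bigr => i _; rewrite /prod_coord row_mxEr mnmE.
Qed.

Lemma sliceE (F : 'O(aprod Y Z)) (s : seq ('O(Y) * 'O(Z))) z :
  (forall y z, F (y, z) = \sum_(u <- s) u.1 y * u.2 z) ->
  slice z F = \sum_(u <- s) (u.2 z : K) *: u.1.
Proof.
move=> hF; apply: regfunP => y; rewrite regfun_sumE /= hF.
by apply: eq_bigr => u _; rewrite mulrC.
Qed.

Lemma tensid_regular (D : {linear 'O(Y) -> 'O(Y)}) (F : 'O(aprod Y Z)) :
  ((fun w : aprod Y Z => D (slice w.2 F) w.1) : aprod Y Z -> K^o)
    \in @regular K (aprod Y Z).
Proof.
have [s hs] := regfun_prodP F.
pose t (u : 'O(Y) * 'O(Z)) : 'O(aprod Y Z) :=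
  pullback (@morphism_fst K Y Z) (D u.1) * pullback (@morphism_snd K Y Z) u.2.
apply: eq_regular (regfun_regular (\sum_(u <- s) t u)) => -[y z] /=.
rewrite (sliceE z hs) linear_sum !regfun_sumE; apply: eq_bigr => u _.
by rewrite linearZ /= mulrC.
Qed.

(* D \otimes id : apply D in the first variable, the second one being fixed. *)
Definition tensid (D : {linear 'O(Y) -> 'O(Y)}) (F : 'O(aprod Y Z)) :
  'O(aprod Y Z) := RegFun (tensid_regular D F).

Lemma tensid_is_linear D : linear (tensid D).
Proof.
by move=> c F G; apply: regfunP => -[y z] /=; rewrite [slice _ _]linearP linearP.
Qed.
HB.instance Definition _ D :=
  GRing.isLinear.Build K 'O(aprod Y Z) 'O(aprod Y Z) _ (tensid D)
    (tensid_is_linear D).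

End TensId.

Section Legs.
Variables (K : closedFieldType) (X : affVariety K).
Notation X2 := (aprod X X).
Notation X3 := (aprod (aprod X X) X).

Definition swap23 (w : X3) : X3 := ((w.1.1, w.2), w.1.2).
Definition rot (w : X3) : X3 := ((w.1.2, w.2), w.1.1).
Definition rotV (w : X3) : X3 := ((w.2, w.1.1), w.1.2).

Lemma morphism_pr1 : morphism (fun w : X3 => w.1.1).
Proof. exact: morphism_o (@morphism_fst K X2 X) (@morphism_fst K X X). Qed.
Lemma morphism_pr2 : morphism (fun w : X3 => w.1.2).
Proof. exact: morphism_o (@morphism_fst K X2 X) (@morphism_snd K X X). Qed.
Lemma morphism_pr3 : morphism (fun w : X3 => w.2).
Proof. exact: (@morphism_snd K X2 X). Qed.

Lemma morphism_swap23 : morphism swap23.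
Proof.
exact: morphism_pair (morphism_pair morphism_pr1 morphism_pr3) morphism_pr2.
Qed.
Lemma morphism_rot : morphism rot.
Proof.
exact: morphism_pair (morphism_pair morphism_pr2 morphism_pr3) morphism_pr1.
Qed.
Lemma morphism_rotV : morphism rotV.
Proof.
exact: morphism_pair (morphism_pair morphism_pr3 morphism_pr1) morphism_pr2.
Qed.

(* r^{13} and r^{23} are obtained from r \otimes id by permuting the factors of
   X^3; see op12E, op13E and op23E for the pointwise formulas. *)
Definition op12 (D : {linear 'O(X2) -> 'O(X2)}) (F : 'O(X3)) : 'O(X3) :=
  tensid D F.
Definition op13 (D : {linear 'O(X2) -> 'O(X2)}) (F : 'O(X3)) : 'O(X3) :=
  pullback morphism_swap23 (tensid D (pullback morphism_swap23 F)).
Definition op23 (D : {linear 'O(X2) -> 'O(X2)}) (F : 'O(X3)) : 'O(X3) :=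
  pullback morphism_rot (tensid D (pullback morphism_rotV F)).

Lemma op12E D (F : 'O(X3)) x y z (G : 'O(X2)) :
  (forall x' y', G (x', y') = F ((x', y'), z)) -> op12 D F ((x, y), z) = D G (x, y).
Proof.
by move=> GE; congr (D _ _); apply: regfunP => -[x' y'] /=; rewrite GE.
Qed.

Lemma op13E D (F : 'O(X3)) x y z (G : 'O(X2)) :
  (forall x' z', G (x', z') = F ((x', y), z')) -> op13 D F ((x, y), z) = D G (x, z).
Proof.
by move=> GE; congr (D _ _); apply: regfunP => -[x' z'] /=; rewrite GE.
Qed.

Lemma op23E D (F : 'O(X3)) x y z (G : 'O(X2)) :
  (forall y' z', G (y', z') = F ((x, y'), z')) -> op23 D F ((x, y), z) = D G (y, z).
Proof.
by move=> GE; congr (D _ _); apply: regfunP => -[y' z'] /=; rewrite GE.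
Qed.

Lemma pullback_is_linear (Y Z : affVariety K) (phi : Y -> Z) (h : morphism phi) :
  linear (pullback h).
Proof. by move=> c F G; exact: regfunP. Qed.

Lemma pullbackM (Y Z : affVariety K) (phi : Y -> Z) (h : morphism phi) F G :
  pullback h (F * G) = pullback h F * pullback h G.
Proof. exact: regfunP. Qed.

Lemma pullbackD (Y Z : affVariety K) (phi : Y -> Z) (h : morphism phi) F G :
  pullback h (F + G) = pullback h F + pullback h G.
Proof. exact: regfunP. Qed.

Lemma op12_is_linear D : linear (op12 D).
Proof. exact: linearP. Qed.
Lemma op13_is_linear D : linear (op13 D).
Proof. by move=> c F G; rewrite /op13 pullback_is_linear linearP pullback_is_linear. Qed.
Lemma op23_is_linear D : linear (op23 D).
Proof. by move=> c F G; rewrite /op23 pullback_is_linear linearP pullback_is_linear. Qed.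

HB.instance Definition _ D :=
  GRing.isLinear.Build K 'O(X3) 'O(X3) _ (op12 D) (op12_is_linear D).
HB.instance Definition _ D :=
  GRing.isLinear.Build K 'O(X3) 'O(X3) _ (op13 D) (op13_is_linear D).
HB.instance Definition _ D :=
  GRing.isLinear.Build K 'O(X3) 'O(X3) _ (op23 D) (op23_is_linear D).

Lemma tensid_leibniz (r : 'Vect(X2)) (F G : 'O(X3)) :
  tensid r (F * G) = tensid r F * G + F * tensid r G.
Proof.
apply: regfunP => -[w z] /=.
have -> : slice z (F * G) = slice z F * slice z G by exact: regfunP.
by rewrite vf_leibniz.
Qed.

Lemma op12_leibniz (r : 'Vect(X2)) F G :
  op12 r (F * G) = op12 r F * G + F * op12 r G.
Proof. exact: tensid_leibniz. Qed.
Lemma op13_leibniz (r : 'Vect(X2)) F G :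
  op13 r (F * G) = op13 r F * G + F * op13 r G.
Proof.
rewrite /op13 pullbackM tensid_leibniz pullbackD !pullbackM.
by congr (_ * _ + _ * _); apply: regfunP => -[[x y] z].
Qed.
Lemma op23_leibniz (r : 'Vect(X2)) F G :
  op23 r (F * G) = op23 r F * G + F * op23 r G.
Proof.
rewrite /op23 pullbackM tensid_leibniz pullbackD !pullbackM.
by congr (_ * _ + _ * _); apply: regfunP => -[[x y] z].
Qed.

Definition vf12 (r : 'Vect(X2)) : 'Vect(X3) :=
  @VectorField K X3 (op12 r) (op12_leibniz r).
Definition vf13 (r : 'Vect(X2)) : 'Vect(X3) :=
  @VectorField K X3 (op13 r) (op13_leibniz r).
Definition vf23 (r : 'Vect(X2)) : 'Vect(X3) :=
  @VectorField K X3 (op23 r) (op23_leibniz r).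

Definition classical_yang_baxter (r : 'Vect(X2)) : Prop :=
  forall F : 'O(X3),
    lie (vf12 r) (vf13 r) F + lie (vf12 r) (vf23 r) F
      + lie (vf13 r) (vf23 r) F = 0.

End Legs.

(* [F k] is the coefficient of hbar^k in [F : fps A]; the product is the Cauchy
   product, not the pointwise product of functions. *)
Definition fps (A : Type) : Type := nat -> A.

HB.instance Definition _ (A : zmodType) := GRing.Zmodule.copy (fps A) (nat -> A).

Lemma fpsP (A : Type) (F G : fps A) : (forall k, F k = G k) -> F = G.
Proof. by move=> ?; apply/funext. Qed.

Definition fpsC (A : zmodType) (a : A) : fps A :=
  fun k => if k is 0%N then a else 0.

Section FpsRing.
Variables (A : pzRingType).

Definition fps_mul (F G : fps A) : fps A :=
  fun n => \sum_(i < n.+1) F i * G (n - i)%N.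

Definition fps_scale (V : lmodType A) (F : fps A) (G : fps V) : fps V :=
  fun n => \sum_(i < n.+1) F i *: G (n - i)%N.

Variable V : lmodType A.

Lemma fps_scale_rev (F : fps A) (G : fps V) n :
  fps_scale F G n = \sum_(i < n.+1) F (n - i)%N *: G i.
Proof.
rewrite /fps_scale (reindex_inj rev_ord_inj) /=.
by apply: eq_bigr => i _; rewrite subSS subKn // -ltnS.
Qed.

Lemma fps_scaleA (F G : fps A) (H : fps V) :
  fps_scale F (fps_scale G H) = fps_scale (fps_mul F G) H.
Proof.
apply: fpsP => i; rewrite [RHS]fps_scale_rev.
pose coef3 j k := F j *: (G (i - j - k)%N *: H k).
transitivity (\sum_(j < i.+1) \sum_(k < i.+1 | (k <= i - j)%N) coef3 j k).
  apply: eq_bigr => /= j _; rewrite fps_scale_rev scaler_sumr /=.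
  by rewrite (big_ord_narrow_leq (leq_subr _ _)).
rewrite (exchange_big_dep predT) //=; apply: eq_bigr => k _.
transitivity (\sum_(j < i.+1 | (j <= i - k)%N) coef3 j k).
  apply: eq_bigl => j; rewrite -ltnS -(ltnS j) -!subSn ?leq_ord //.
  by rewrite -subn_gt0 -(subn_gt0 j) -!subnDA addnC.
rewrite (big_ord_narrow_leq (leq_subr _ _)) scaler_suml /=.
by apply: eq_bigr => j _; rewrite /coef3 -!subnDA addnC scalerA.
Qed.

Lemma fps_scaleC a (G : fps V) n : fps_scale (fpsC a) G n = a *: G n.
Proof.
by rewrite /fps_scale big_ord_recl /= subn0 big1 ?addr0 // => i _; rewrite scale0r.
Qed.

Lemma fps_scale1 : left_id (fpsC 1) (@fps_scale V).
Proof. by move=> G; apply: fpsP => n; rewrite fps_scaleC scale1r. Qed.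

Lemma fps_scaleDr : right_distributive (@fps_scale V) +%R.
Proof.
move=> F G H; apply: fpsP => n.
change (fps_scale F (G + H) n = fps_scale F G n + fps_scale F H n).
rewrite /fps_scale -big_split /=.
by apply: eq_bigr => i _; rewrite -scalerDr.
Qed.

Lemma fps_scaleDl (H : fps V) : {morph (@fps_scale V)^~ H : F G / F + G}.
Proof.
move=> F G; apply: fpsP => n.
change (fps_scale (F + G) H n = fps_scale F H n + fps_scale G H n).
rewrite /fps_scale -big_split /=.
by apply: eq_bigr => i _; rewrite -scalerDl.
Qed.

End FpsRing.

Lemma fps_mulC (A : comPzRingType) : commutative (@fps_mul A).
Proof.
move=> F G; apply: fpsP => n; rewrite [LHS](fps_scale_rev (V := A^o)).
by apply: eq_bigr => i _; exact: mulrC.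
Qed.

HB.instance Definition _ (A : comPzRingType) :=
  GRing.Zmodule_isComPzRing.Build (fps A)
    (fun F G H => fps_scaleA F G (H : fps A^o)) (@fps_mulC A)
    (@fps_scale1 A A^o) (fun F G H => @fps_scaleDl A A^o H F G).

HB.instance Definition _ (K : comPzRingType) (V : lmodType K) :=
  GRing.Zmodule_isLmodule.Build (fps K) (fps V) (@fps_scaleA K V)
    (@fps_scale1 K V) (@fps_scaleDr K V) (@fps_scaleDl K V).

Lemma fps_mulE (A : comPzRingType) (F G : fps A) n :
  (F * G) n = \sum_(i < n.+1) F i * G (n - i)%N.
Proof. by []. Qed.

Lemma fps_oneE (A : comPzRingType) : 1 = fpsC 1 :> fps A.
Proof. by []. Qed.

Lemma fps_scaleE (K : comPzRingType) (V : lmodType K) (c : fps K) (F : fps V) n :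
  (c *: F) n = \sum_(i < n.+1) c i *: F (n - i)%N.
Proof. by []. Qed.

Definition fps_map (A B : Type) (D : A -> B) (F : fps A) : fps B := fun k => D (F k).

Definition hbar (A : pzRingType) : fps A := fun k => (k == 1%N)%:R.
Arguments hbar {A}.

(* Congruence modulo hbar^N. *)
Definition hbar_cong (A : Type) (N : nat) (F G : fps A) : Prop :=
  forall k, (k < N)%N -> F k = G k.

Definition hbar_continuous (A B : Type) (T : fps A -> fps B) : Prop :=
  forall F N, exists M, forall G, hbar_cong M F G -> hbar_cong N (T F) (T G).

(* sum_k hbar^k T_k, the hbar-adically continuous extension to power series. *)
Definition fps_series (A B : zmodType) (T : nat -> A -> B) (F : fps A) : fps B :=
  fun n => \sum_(k < n.+1) T k (F (n - k)%N).

(* Linearity is over the ring of scalars fps K = K[[hbar]]. *)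
Record formalDiffeo (K : closedFieldType) (Y : affVariety K) := FormalDiffeo {
  fd_map :> {linear fps 'O(Y) -> fps 'O(Y)};
  fd_monoid_morphism : monoid_morphism fd_map;
  fd_bijective : bijective fd_map;
  fd_continuous : hbar_continuous fd_map;
  fd_id_mod : forall F, hbar_cong 1 (fd_map F) F
}.

Section Coefficients.
Variables (K : closedFieldType) (Y : affVariety K) (R : formalDiffeo Y).

(* R = sum_k hbar^k fd_coef k. *)
Definition fd_coef (k : nat) (f : 'O(Y)) : 'O(Y) := R (fpsC f) k.

Lemma fd_coef_is_linear k : linear (fd_coef k).
Proof.
move=> c f g; rewrite /fd_coef.
have -> : fpsC (c *: f + g) = (fpsC c : fps K) *: fpsC f + fpsC g.
  apply: fpsP => j.
  rewrite [RHS](_ : _ = fps_scale (fpsC c : fps K) (fpsC f) j + fpsC g j) //.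
  by rewrite fps_scaleC; case: j => //= _; rewrite scaler0 addr0.
rewrite linearP.
rewrite [LHS](_ : _ = fps_scale (fpsC c : fps K) (R (fpsC f)) k + R (fpsC g) k) //.
by rewrite fps_scaleC.
Qed.
HB.instance Definition _ k :=
  GRing.isLinear.Build K 'O(Y) 'O(Y) _ (fd_coef k) (fd_coef_is_linear k).

Lemma fps_add (A : zmodType) (F G : fps A) n : (F + G) n = F n + G n.
Proof. by []. Qed.

Lemma fps_sum (A : zmodType) (I : Type) (s : seq I) (F : I -> fps A) n :
  (\sum_(i <- s) F i) n = \sum_(i <- s) F i n.
Proof. by elim/big_rec2: _ => // i a b _ <-. Qed.

Definition hbarX (k : nat) : fps K := fun j => (j == k)%:R.

Lemma hbarXE (V : lmodType K) k (F : fps V) n :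
  (hbarX k *: F) n = if (k <= n)%N then F (n - k)%N else 0.
Proof.
rewrite [LHS](_ : _ = fps_scale (hbarX k) F n) // /fps_scale /hbarX.
case: leqP => kn; last first.
  rewrite big1 // => i _; case: eqP => [ik|_]; last by rewrite scale0r.
  by move: (ltn_ord i); rewrite ik ltnS leqNgt kn.
rewrite (bigD1 (Ordinal (kn : (k < n.+1)%N))) //= eqxx scale1r big1 ?addr0 //.
move=> i /eqP ik; case: eqP => [e|_]; last by rewrite scale0r.
by case: ik; apply: val_inj.
Qed.

Lemma fd_series F : R F = fps_series fd_coef F.
Proof.
apply: fpsP => n; rewrite /fps_series.
pose P : fps 'O(Y) := \sum_(k < n.+1) hbarX k *: fpsC (F k).
pose G : fps 'O(Y) := fun j => F (j + n.+1)%N.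
have FE : F = P + hbarX n.+1 *: G.
  apply: fpsP => j; rewrite fps_add /P fps_sum hbarXE.
  case: leqP => hj; last first.
    rewrite /G subnK // big1 ?add0r // => i _; rewrite hbarXE.
    have ij : (i < j)%N by exact: leq_trans (ltn_ord i) hj.
    by rewrite (ltnW ij); move: ij; rewrite -subn_gt0; case: (j - i)%N.
  rewrite addr0 (bigD1 (Ordinal (hj : (j < n.+1)%N))) //= hbarXE leqnn subnn.
  rewrite big1 ?addr0 // => i /eqP ne; rewrite hbarXE; case: leqP => // ij.
  case e : (j - i)%N => [|//]; case: ne; apply: val_inj => /=.
  by apply/eqP; rewrite eqn_leq ij -subn_eq0 e.
rewrite {1}FE linearD linearZ fps_add /= hbarXE ltnn addr0 /P linear_sum fps_sum.
rewrite (reindex_inj rev_ord_inj) /=; apply: eq_bigr => k _.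
have kn : (k <= n)%N by rewrite -ltnS.
by rewrite linearZ /= hbarXE subSS leq_subr subKn.
Qed.

End Coefficients.

Section DiffeoLegs.
Variables (K : closedFieldType) (X : affVariety K) (R : formalDiffeo (aprod X X)).
Notation X2 := (aprod X X).
Notation X3 := (aprod (aprod X X) X).

(* R^{ij} is the K[[hbar]]-linear, hbar-adically continuous extension of the
   action of R in the factors i and j; see fd12E, fd13E and fd23E. *)
Definition fd12 : fps 'O(X3) -> fps 'O(X3) := fps_series (fun k => op12 (fd_coef R k)).
Definition fd13 : fps 'O(X3) -> fps 'O(X3) := fps_series (fun k => op13 (fd_coef R k)).
Definition fd23 : fps 'O(X3) -> fps 'O(X3) := fps_series (fun k => op23 (fd_coef R k)).

Lemma fd12E (F : fps 'O(X3)) n x y z (G : fps 'O(X2)) :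
  (forall k x' y', G k (x', y') = F k ((x', y'), z)) ->
  fd12 F n ((x, y), z) = R G n (x, y).
Proof.
move=> GE; rewrite fd_series /fd12 /fps_series !regfun_sumE.
by apply: eq_bigr => k _; apply: op12E => x' y'; rewrite GE.
Qed.

Lemma fd13E (F : fps 'O(X3)) n x y z (G : fps 'O(X2)) :
  (forall k x' z', G k (x', z') = F k ((x', y), z')) ->
  fd13 F n ((x, y), z) = R G n (x, z).
Proof.
move=> GE; rewrite fd_series /fd13 /fps_series !regfun_sumE.
by apply: eq_bigr => k _; apply: op13E => x' z'; rewrite GE.
Qed.

Lemma fd23E (F : fps 'O(X3)) n x y z (G : fps 'O(X2)) :
  (forall k y' z', G k (y', z') = F k ((x, y'), z')) ->
  fd23 F n ((x, y), z) = R G n (y, z).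
Proof.
move=> GE; rewrite fd_series /fd23 /fps_series !regfun_sumE.
by apply: eq_bigr => k _; apply: op23E => y' z'; rewrite GE.
Qed.

(* The product of formal diffeomorphisms is their composition as operators. *)
Definition quantum_yang_baxter : Prop :=
  forall F : fps 'O(X3), fd12 (fd13 (fd23 F)) = fd23 (fd13 (fd12 F)).

(* R = 1 + hbar r + O(hbar^2). *)
Definition first_order (r : 'Vect(X2)) : Prop :=
  forall F : fps 'O(X2),
    hbar_cong 2 (R F) (F + (hbar : fps K) *: fps_map r F).

End DiffeoLegs.

(* Main.v *)
(* Split r into A f = r (f (x) 1) and B f = r (1 (x) f): A_z is a vector field
   depending on a point z and B_x one depending on x, and r moves x along A_y and
   y along B_x. On X^n let A_ji (resp. B_ji) be the vector field moving the
   coordinate x_i with parameter x_j, where i = j is allowed, so that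
   r^ij = A_ji + B_ij. The three components of the classical Yang-Baxter equation
   are identities between functions of three points; allowing the points to
   coincide they say in particular that
     [B_11 + B_12, A_22 + A_21] = 0,  [A_22 + B_22, A_21] = [A_22 + B_22, B_23] = 0.
   The quantization is
     R = e^(- h A_22) e^(h (A_22 + B_11 + r)) e^(- h B_11) = L_21 P_12,
   where the shear L_ji = e^(- h A_jj) e^(h (A_jj + A_ji)) moves only x_i and
   P_ij = e^(h (B_ii + B_ij)) e^(- h B_ii) moves only x_j. The quantum Yang-Baxter
   equation follows from three exchange relations between shears on X^3, each of
   which reduces to the vanishing of the commutator of two sums of three of these
   vector fields, for instance
     [B_11 + B_12 + B_13, A_33 + A_31 + A_32] = 0. *)

From HB Require Import structures.
Require Import Defs.
From mathcomp Require Import all_boot all_order all_algebra.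
From mathcomp Require Import reals complex.
From mathcomp Require Import boolp ring.

Set Implicit Arguments.
Unset Strict Implicit.
Unset Printing Implicit Defensive.

Import GRing.Theory.

Local Open Scope ring_scope.

(** * Exponentials of operators on formal power series *)

Definition deriv_fps (A : zmodType) (F : fps A) : fps A := fun n => F n.+1 *+ n.+1.

(** This is [e^(h D)] with [D] acting coefficientwise; the powers of h are supplied by [fps_series],
    which shifts the k-th term by k places. *)
Definition exph (K : fieldType) (V : lmodType K) (D : V -> V) (F : fps V) : fps V :=
  fps_series (fun k v => (k`!%:R : K)^-1 *: iter k D v) F.

Lemma exph_intertwine (K : fieldType) (V W : lmodType K) (h : {linear V -> W})
    (D : V -> V) (E : W -> W) (F : fps V) :
  (forall v, h (D v) = E (h v)) -> fps_map h (exph D F) = exph E (fps_map h F).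
Proof.
move=> hDE; apply: fpsP => n; rewrite /fps_map linear_sum; apply: eq_bigr => k _.
rewrite linearZ /=; congr (_ *: _).
by elim: (k : nat) (F _) => //= j IH v; rewrite hDE IH.
Qed.

Section Exponential.
Variables (K : fieldType) (K0 : [pchar K] =i pred0) (V : lmodType K).
Implicit Types (D E S : {linear V -> V}) (F G : fps V).

Lemma natrS_neq0 n : n.+1%:R != 0 :> K.
Proof. by rewrite (pcharf0P K).1. Qed.

Lemma mulrnS_inj n : injective (fun v : V => v *+ n.+1).
Proof.
move=> v w /= /(congr1 (fun u => (n.+1%:R : K)^-1 *: u)).
by rewrite -!(scaler_nat n.+1) !scalerA mulVf ?natrS_neq0 // !scale1r.
Qed.

Lemma exph0 D F : exph D F 0 = F 0%N.
Proof. by rewrite /exph /fps_series big_ord1 /= fact0 invr1 scale1r. Qed.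

Lemma exph1 D F : exph D F 1 = F 1%N + D (F 0%N).
Proof.
rewrite /exph /fps_series big_ord_recl big_ord1 /= subn0 subnn.
by rewrite !factE !invr1 !scale1r.
Qed.

Lemma iter_linear D k : linear (iter k D).
Proof. by elim: k => [|k IH] a u v //=; rewrite IH linearP. Qed.

Lemma iterMn D k v n : iter k D (v *+ n) = iter k D v *+ n.
Proof. by elim: k => //= k ->; rewrite raddfMn. Qed.

(** This is the product rule for the h-derivative of [e^(h D) F], read at the coefficient of [h^n].
    The factor [n+1] splits as [k + (n+1-k)]: the first part turns [k!] into [(k-1)!], the second
    differentiates [F]. *)
Lemma exphS D F n :
  exph D F n.+1 *+ n.+1 = D (exph D F n) + exph D (deriv_fps F) n.
Proof.
rewrite /exph /fps_series linear_sum.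
transitivity (\sum_(k < n.+2) ((k`!%:R : K)^-1 *: iter k D (F (n.+1 - k)%N) *+ k) +
  \sum_(k < n.+2) ((k`!%:R : K)^-1 *: iter k D (F (n.+1 - k)%N) *+ (n.+1 - k))).
  rewrite -big_split -sumrMnl; apply: eq_bigr => k _ /=.
  by rewrite -mulrnDr subnKC // -ltnS.
congr (_ + _).
  rewrite big_ord_recl mulr0n add0r; apply: eq_bigr => k _ /=.
  rewrite subSS linearZ -[LHS]scaler_nat scalerA factS natrM invfM mulrA.
  by rewrite mulfV ?mul1r // natrS_neq0.
rewrite big_ord_recr /= subnn mulr0n addr0; apply: eq_bigr => k _ /=.
by rewrite /deriv_fps iterMn subSn 1?scalerMnr // -ltnS.
Qed.

(** Characteristic zero lets the differential equation be solved coefficient by coefficient. The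
    induction treats all [F] at once because the derivative of [F] enters the equation. *)
Lemma exph_uniq D (T : fps V -> fps V) :
  (forall F, T F 0%N = F 0%N) ->
  (forall F n, T F n.+1 *+ n.+1 = D (T F n) + T (deriv_fps F) n) ->
  forall F, T F = exph D F.
Proof.
move=> T0 TS F; apply: fpsP => n; elim: n F => [|n IH] F; first by rewrite T0 exph0.
by apply: (@mulrnS_inj n); rewrite /= TS exphS !IH.
Qed.

Lemma eq_exph D E : D =1 E -> exph D =1 exph E.
Proof.
move=> DE F; apply: fpsP => n; apply: eq_bigr => k _.
by congr (_ *: _); apply: eq_iter.
Qed.

Lemma exph_is_additive D F G : exph D (F + G) = exph D F + exph D G.
Proof.
apply: fpsP => n; rewrite fps_add -big_split; apply: eq_bigr => k _ /=.
by rewrite fps_add -scalerDr -(scale1r (iter k D (F _))) -iter_linear scale1r.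
Qed.

Lemma exph_map D E F : (forall v, D (E v) = E (D v)) ->
  exph D (fps_map E F) = fps_map E (exph D F).
Proof. by move=> DE; rewrite (@exph_intertwine _ _ _ E D D). Qed.

Lemma deriv_exph D F :
  deriv_fps (exph D F) = fps_map D (exph D F) + exph D (deriv_fps F).
Proof. by apply: fpsP => n; rewrite fps_add -exphS. Qed.

(** Since [e^(h D)] commutes with [E], the product [e^(h D) e^(h E)] satisfies the differential
    equation that characterizes [e^(h S)]. *)
Lemma exphD S D E : (forall v, S v = D v + E v) ->
  (forall v, D (E v) = E (D v)) -> forall F, exph S F = exph D (exph E F).
Proof.
move=> SE DE F; symmetry; move: F; apply: exph_uniq => [F|F n].
  by rewrite !exph0.
by rewrite exphS deriv_exph exph_is_additive fps_add exph_map // SE addrA.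
Qed.

Lemma exph_zero F : exph \0 F = F.
Proof.
have := @exph_uniq (\0 : {linear V -> V}) id (fun=> erefl).
by move=> /(_ (fun _ _ => esym (add0r _)) F).
Qed.

Lemma exphK D : cancel (exph D) (exph (\- D)).
Proof.
move=> F; rewrite -(@exphD \0) ?exph_zero // => v /=; first by rewrite addNr.
by rewrite raddfN.
Qed.

Lemma exph_cong N D F G : hbar_cong N F G -> hbar_cong N (exph D F) (exph D G).
Proof.
move=> FG k kN; apply: eq_bigr => i _; congr (_ *: iter _ _ _).
by apply: FG; apply: leq_ltn_trans (leq_subr _ _) kN.
Qed.

Lemma exph_comm D E : (forall v, D (E v) = E (D v)) ->
  forall F, exph D (exph E F) = exph E (exph D F).
Proof.
move=> DE F; rewrite -(@exphD (D \+ E)) // -(@exphD (D \+ E)) // => v.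
by rewrite /= addrC.
Qed.

Lemma exph_preserves (Q : V -> Prop) D F :
  Q 0 -> (forall u v, Q u -> Q v -> Q (u + v)) -> (forall a v, Q v -> Q (a *: v)) ->
  (forall v, Q v -> Q (D v)) -> (forall n, Q (F n)) -> forall n, Q (exph D F n).
Proof.
move=> Q0 QD QZ QDD QF n; apply: big_ind => // k _; apply: QZ.
by elim: {1}(k : nat) => //= j; exact: QDD.
Qed.

(** Only the iterates of [D] on the coefficients of [F] matter, and they never leave the invariant
    set [Q]. *)
Lemma exph_eq_on (Q : V -> Prop) D E F : (forall v, Q v -> Q (D v)) ->
  (forall v, Q v -> D v = E v) -> (forall n, Q (F n)) -> exph D F = exph E F.
Proof.
move=> QD DE QF; apply: fpsP => n; apply: eq_bigr => k _; congr (_ *: _).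
suff [] : Q (iter k D (F (n - k)%N)) /\
  iter k D (F (n - k)%N) = iter k E (F (n - k)%N) by [].
elim: {1 3 5}(k : nat) => //= j [Qj <-].
by split; [exact: QD | exact: DE].
Qed.

End Exponential.

(** The module form serves both the product of two series of functions and the action of scalar
    series. *)
Lemma deriv_fps_scale (A : pzRingType) (V : lmodType A) (F : fps A) (G : fps V) :
  deriv_fps (fps_scale F G) = fps_scale (deriv_fps F) G + fps_scale F (deriv_fps G).
Proof.
apply: fpsP => n; rewrite fps_add /deriv_fps {1}/fps_scale.
transitivity (\sum_(k < n.+2) (F k *: G (n.+1 - k)%N *+ k) +
              \sum_(k < n.+2) (F k *: G (n.+1 - k)%N *+ (n.+1 - k))).
  rewrite -big_split -sumrMnl; apply: eq_bigr => k _ /=.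
  by rewrite -mulrnDr subnKC // -ltnS.
congr (_ + _).
  rewrite big_ord_recl mulr0n add0r; apply: eq_bigr => k _ /=.
  by rewrite subSS scalerMnl.
rewrite big_ord_recr /= subnn mulr0n addr0; apply: eq_bigr => k _ /=.
by rewrite subSn 1?scalerMnr // -ltnS.
Qed.

(** * Vector fields and their exponentials as formal diffeomorphisms *)

Section VectorFieldOperations.
Variables (K : closedFieldType) (Y : affVariety K).
Implicit Types D E : 'Vect(Y).

Lemma vf_add_leibniz D E (f g : 'O(Y)) :
  (D \+ E) (f * g) = (D \+ E) f * g + f * (D \+ E) g.
Proof. by rewrite /= !vf_leibniz; ring. Qed.
Definition vf_add D E : 'Vect(Y) := VectorField (vf_add_leibniz D E).

Lemma vf_opp_leibniz D (f g : 'O(Y)) :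
  (\- D) (f * g) = (\- D) f * g + f * (\- D) g.
Proof. by rewrite /= vf_leibniz; ring. Qed.
Definition vf_opp D : 'Vect(Y) := VectorField (vf_opp_leibniz D).

Lemma vf_map_mul D (F G : fps 'O(Y)) :
  fps_map D (F * G) = fps_map D F * G + F * fps_map D G.
Proof.
apply: fpsP => n; rewrite fps_add /fps_map !fps_mulE linear_sum -big_split.
by apply: eq_bigr => i _; rewrite vf_leibniz.
Qed.

End VectorFieldOperations.

Section FormalDiffeoExponential.
Variables (K : closedFieldType) (K0 : [pchar K] =i pred0) (Y : affVariety K).
Implicit Types (D E : 'Vect(Y)) (F G : fps 'O(Y)) (R S : formalDiffeo Y).

Lemma deriv_fps_mul F G : deriv_fps (F * G) = deriv_fps F * G + F * deriv_fps G.
Proof. exact: (@deriv_fps_scale 'O(Y) 'O(Y)^o). Qed.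

(** As [D] is a derivation, both sides solve the same differential equation in h; the induction runs
    over all pairs [F], [G], which get differentiated on the way. *)
Lemma exph_mul D F G : exph D (F * G) = exph D F * exph D G.
Proof.
apply: fpsP => n; elim: n F G => [|n IH] F G.
  by rewrite exph0 !fps_mulE !big_ord1 !exph0.
apply: (mulrnS_inj K0 (n := n)); rewrite /= exphS // deriv_fps_mul exph_is_additive.
rewrite fps_add !IH -[RHS]/(deriv_fps (exph D F * exph D G : fps 'O(Y)) n).
rewrite deriv_fps_mul !deriv_exph // mulrDl mulrDr.
rewrite -[D _]/(fps_map D (exph D F * exph D G : fps 'O(Y)) n).
by rewrite vf_map_mul -fps_add addrACA.
Qed.

Lemma exph_scale D (c : fps K) F : exph D (c *: F) = c *: exph D F.
Proof.
apply: fpsP => n; elim: n c F => [|n IH] c F.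
  by rewrite exph0 !fps_scaleE !big_ord1 !exph0.
apply: (mulrnS_inj K0 (n := n)); rewrite /= exphS //.
have -> : deriv_fps (c *: F) = deriv_fps c *: F + c *: deriv_fps F.
  exact: (@deriv_fps_scale K 'O(Y) c F).
rewrite exph_is_additive fps_add !IH.
rewrite -[RHS]/(deriv_fps (fps_scale c (exph D F) : fps 'O(Y)) n).
rewrite deriv_fps_scale deriv_exph // fps_scaleDr -[D _]/(fps_map D (c *: exph D F) n).
have -> : fps_map D (c *: exph D F) = fps_scale c (fps_map D (exph D F)).
  apply: fpsP => k; rewrite /fps_map /= linear_sum.
  by apply: eq_bigr => i _; rewrite linearZ.
by rewrite -fps_add addrCA.
Qed.

Lemma exph_is_linear D : linear (exph D : fps 'O(Y) -> fps 'O(Y)).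
Proof. by move=> c F G; rewrite exph_is_additive exph_scale. Qed.

Lemma exphNK D : cancel (exph (vf_opp D)) (exph D).
Proof.
move=> F; rewrite -[RHS](exphK K0 (vf_opp D)); apply: eq_exph => f.
by rewrite /= opprK.
Qed.

Lemma exph_is_monoid_morphism D : monoid_morphism (exph D : fps 'O(Y) -> fps 'O(Y)).
Proof.
split=> [|F G]; last exact: exph_mul.
(* Multiplicativity gives the unit law once the inserted factor 1 is written as
   [e^(h D) (e^(- h D) 1)]. *)
by rewrite -[LHS]mulr1 -[X in _ * X](exphNK D) -exph_mul mul1r exphNK.
Qed.

Definition exph_linear D : {linear fps 'O(Y) -> fps 'O(Y)} :=
  HB.pack (exph D : fps 'O(Y) -> fps 'O(Y))
    (GRing.isLinear.Build (fps K) (fps 'O(Y)) (fps 'O(Y)) _ (exph D) (exph_is_linear D)).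

Lemma exph_bij D : bijective (exph D : fps 'O(Y) -> fps 'O(Y)).
Proof. by exists (exph (vf_opp D)); [exact: exphK | exact: exphNK]. Qed.

Lemma exph_continuous D : hbar_continuous (exph D : fps 'O(Y) -> fps 'O(Y)).
Proof. by move=> F N; exists N => G; exact: exph_cong. Qed.

Lemma exph_id_mod D F : hbar_cong 1 (exph D F) F.
Proof. by case=> // _; rewrite exph0. Qed.

Definition fd_exp D : formalDiffeo Y :=
  @FormalDiffeo K Y (exph_linear D) (exph_is_monoid_morphism D) (exph_bij D)
    (@exph_continuous D) (@exph_id_mod D).

End FormalDiffeoExponential.

Section FormalDiffeoComposition.
Variables (K : closedFieldType) (Y : affVariety K) (R S : formalDiffeo Y).

Lemma fd_comp_monoid_morphism : monoid_morphism (R \o S).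
Proof.
have [R1 RM] := fd_monoid_morphism R; have [S1 SM] := fd_monoid_morphism S.
by split=> [|F G] /=; rewrite ?S1 ?R1 // SM RM.
Qed.

Lemma fd_comp_bij : bijective (R \o S).
Proof. exact: bij_comp (fd_bijective R) (fd_bijective S). Qed.

Lemma fd_comp_continuous : hbar_continuous (R \o S).
Proof.
move=> F N; have [M RM] := fd_continuous R (S F) N.
by have [M' SM] := fd_continuous S F M; exists M' => G /SM/RM.
Qed.

Lemma fd_comp_id_mod F : hbar_cong 1 ((R \o S) F) F.
Proof. by move=> k k1 /=; rewrite (fd_id_mod R) // (fd_id_mod S). Qed.

Definition fd_comp : formalDiffeo Y :=
  @FormalDiffeo K Y (R \o S) fd_comp_monoid_morphism fd_comp_bij
    fd_comp_continuous fd_comp_id_mod.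

End FormalDiffeoComposition.

Section RegfunValues.
Variables (K : closedFieldType) (Y : affVariety K) (f g : 'O(Y)) (y : Y).
Lemma regfun_add : (f + g) y = f y + g y. Proof. by []. Qed.
Lemma regfun_opp : (- f) y = - f y. Proof. by []. Qed.
Lemma regfun_mul : (f * g) y = f y * g y. Proof. by []. Qed.
Lemma regfun_zero : (0 : 'O(Y)) y = 0. Proof. by []. Qed.
End RegfunValues.
Definition regfunE := (regfun_add, regfun_opp, regfun_mul, regfun_zero).

Lemma fpsC_mul (A : comPzRingType) (a b : A) : fpsC (a * b) = fpsC a * fpsC b.
Proof.
apply: fpsP => n; rewrite fps_mulE big_ord_recl /= subn0 big1 => [|i _]; last exact: mul0r.
by rewrite addr0; case: n => [|n] //=; rewrite mulr0.
Qed.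

Lemma fpsC_sum (A : zmodType) (I : Type) (s : seq I) (F : I -> A) :
  fpsC (\sum_(i <- s) F i) = \sum_(i <- s) fpsC (F i).
Proof.
apply: fpsP => n; rewrite fps_sum; case: n => [|n] //=.
by rewrite big1.
Qed.

(** * Functions of one coordinate on X^3 and fields moving one coordinate *)

Inductive leg := leg1 | leg2 | leg3.

Section LegCoordinates.
Variables (K : closedFieldType) (X : affVariety K).
Notation X2 := (aprod X X).
Notation X3 := (aprod (aprod X X) X).
Implicit Types (i j k l : leg) (f g : 'O(X)) (G : 'O(X2)) (F : 'O(X3)) (w : X3).

Definition pr i w : X :=
  match i with leg1 => w.1.1 | leg2 => w.1.2 | leg3 => w.2 end.

Definition upd i w (x : X) : X3 :=
  match i with
  | leg1 => ((x, w.1.2), w.2) | leg2 => ((w.1.1, x), w.2) | leg3 => (w.1, x)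
  end.

Definition others i w : X2 :=
  match i with leg1 => (w.1.2, w.2) | leg2 => (w.1.1, w.2) | leg3 => w.1 end.

Lemma morphism_pr i : morphism (pr i).
Proof. by case: i; [exact: morphism_pr1 | exact: morphism_pr2 | exact: morphism_pr3]. Qed.

Lemma morphism_upd i w : morphism (upd i w).
Proof.
have cst (Z : affVariety K) (z : Z) := @morphism_cst K X Z z.
have I := @morphism_id K X.
case: i; last exact: morphism_pair (cst _ _) I.
  exact: morphism_pair (morphism_pair I (cst _ _)) (cst _ _).
exact: morphism_pair (morphism_pair (cst _ _) I) (cst _ _).
Qed.

Lemma morphism_others i : morphism (others i).
Proof.
case: i; last exact: morphism_fst.
  exact: morphism_pair (@morphism_pr2 K X) (@morphism_pr3 K X).
exact: morphism_pair (@morphism_pr1 K X) (@morphism_pr3 K X).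
Qed.

Definition at1 i f : 'O(X3) := pullback (morphism_pr i) f.
Definition at2 i j G : 'O(X3) :=
  pullback (morphism_pair (morphism_pr i) (morphism_pr j)) G.
Definition freeze i w F : 'O(X) := pullback (morphism_upd i w) F.

Lemma leg_decomp i F : exists s : seq ('O(X) * 'O(X2)),
  forall w, F w = \sum_(u <- s) u.1 (pr i w) * u.2 (others i w).
Proof.
case: i.
- have [s hs] := regfun_prodP (pullback (@morphism_rotV K X) F).
  exists [seq (u.2, u.1) | u <- s] => -[[x y] z]; rewrite big_map.
  have /= -> := hs (y, z) x; by under eq_bigr do rewrite mulrC.
- have [s hs] := regfun_prodP (pullback (@morphism_swap23 K X) F).
  exists [seq (u.2, u.1) | u <- s] => -[[x y] z]; rewrite big_map.
  have /= -> := hs (x, z) y; by under eq_bigr do rewrite mulrC.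
have [s hs] := regfun_prodP F.
exists [seq (u.2, u.1) | u <- s] => -[xy z]; rewrite big_map hs.
by under eq_bigr do rewrite mulrC.
Qed.

Lemma freeze_decomp i w F (s : seq ('O(X) * 'O(X2))) :
  (forall w, F w = \sum_(u <- s) u.1 (pr i w) * u.2 (others i w)) ->
  freeze i w F = \sum_(u <- s) (u.2 (others i w) : K) *: u.1.
Proof.
move=> hs; apply: regfunP => x; rewrite regfun_sumE /= hs.
by apply: eq_bigr => u _; rewrite mulrC; case: i w {hs} => -[[]].
Qed.

Lemma upd_pr i w : upd i w (pr i w) = w.
Proof. by case: i w => -[[]]. Qed.

Lemma freeze_is_linear i w : linear (freeze i w).
Proof. by move=> c F G; exact: regfunP. Qed.

Section LegField.
Variables (i : leg) (phi : 'O(X) -> 'O(X3)) (phi_lin : linear phi).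
Variable phi_leibniz : forall f g, phi (f * g) = phi f * at1 i g + at1 i f * phi g.
HB.instance Definition _ := GRing.isLinear.Build K 'O(X) 'O(X3) _ phi phi_lin.

(** Writing [F] as a finite sum of products [f g], with [f] a function of [x_i] and [g] of the other
    coordinates, turns the value into the sum of the [phi(f) g], which is regular. *)
Lemma leg_regular F : ((fun w => phi (freeze i w F) w) : X3 -> K^o) \in @regular K X3.
Proof.
have [s hs] := leg_decomp i F.
pose t (u : 'O(X) * 'O(X2)) : 'O(X3) := phi u.1 * pullback (morphism_others i) u.2.
apply: eq_regular (regfun_regular (\sum_(u <- s) t u)) => w.
rewrite (freeze_decomp w hs) linear_sum !regfun_sumE; apply: eq_bigr => u _.
by rewrite linearZ /= mulrC.
Qed.

Definition leg_map F : 'O(X3) := RegFun (leg_regular F).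

Lemma leg_map_is_linear : linear leg_map.
Proof.
by move=> c F G; apply: regfunP => w /=; rewrite freeze_is_linear linearP.
Qed.
HB.instance Definition _ :=
  GRing.isLinear.Build K 'O(X3) 'O(X3) _ leg_map leg_map_is_linear.

Lemma leg_map_leibniz (F F' : 'O(X3)) :
  leg_map (F * F') = leg_map F * F' + F * leg_map F'.
Proof.
apply: regfunP => w; rewrite -[LHS]/(phi (freeze i w (F * F')) w).
have -> : freeze i w (F * F') = freeze i w F * freeze i w F' by exact: regfunP.
by rewrite phi_leibniz !regfunE /= upd_pr.
Qed.

Definition vf_leg : 'Vect(X3) := VectorField leg_map_leibniz.

Lemma freeze_at1 w f : freeze i w (at1 i f) = f.
Proof. by apply: regfunP => x; case: i. Qed.

Lemma vf_leg_at1 f : vf_leg (at1 i f) = phi f.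
Proof. by apply: regfunP => w /=; rewrite freeze_at1. Qed.

(** With the other coordinates frozen, [F] is a constant, and the Leibniz rule at [1 * 1] makes
    [phi] vanish on constants. *)
Lemma vf_leg_independent F : (forall w x, F (upd i w x) = F w) -> vf_leg F = 0.
Proof.
move=> iF; apply: regfunP => w /=.
have phi1 : phi 1 = 0.
  apply: (addrI (phi 1)); rewrite addr0 -[in RHS](mulr1 1) phi_leibniz.
  by apply: regfunP => v /=; rewrite mulr1 mul1r.
have -> : freeze i w F = (F w : K) *: (1 : 'O(X)).
  by apply: regfunP => x /=; rewrite iF; apply: esym; exact: mulr1.
by rewrite linearZ /= phi1 scaler0.
Qed.

End LegField.

Lemma at2_decomp k l G : exists s : seq ('O(X) * 'O(X)),
  (forall x y, G (x, y) = \sum_(u <- s) u.1 x * u.2 y) /\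
  at2 k l G = \sum_(u <- s) at1 k u.1 * at1 l u.2.
Proof.
have [s hs] := regfun_prodP G; exists s; split=> //.
by apply: regfunP => w; rewrite regfun_sumE /= hs.
Qed.

Lemma at1_decomp F : exists s : seq ('O(X) * 'O(X) * 'O(X)),
  F = \sum_(u <- s) at1 leg1 u.1.1 * at1 leg2 u.1.2 * at1 leg3 u.2.
Proof.
have [s hs] := leg_decomp leg3 F.
have t (u : 'O(X) * 'O(X2)) := cid (at2_decomp leg1 leg2 u.2).
exists (flatten [seq [seq (v.1, v.2, u.1) | v <- projT1 (t u)] | u <- s]).
rewrite big_flatten big_map.
transitivity (\sum_(u <- s) at1 leg3 u.1 * at2 leg1 leg2 u.2).
  by apply: regfunP => -[[x y] z]; rewrite regfun_sumE hs.
apply: eq_bigr => u _; rewrite big_map; case: (t u) => s' [_ /= ->].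
by rewrite mulrC mulr_suml.
Qed.

Lemma vf_ext (D E : 'Vect(X3)) :
  (forall k f, D (at1 k f) = E (at1 k f)) -> D =1 E.
Proof.
move=> DE F; have [s ->] := at1_decomp F; rewrite !linear_sum.
by apply: eq_bigr => u _; rewrite !vf_leibniz !DE.
Qed.

(** By [fd_series] a formal diffeomorphism is determined by its values on constant series, and there
    multiplicativity reduces to functions of one coordinate. *)
Lemma fd_ext (R S : formalDiffeo X3) :
  (forall k f, R (fpsC (at1 k f)) = S (fpsC (at1 k f))) -> R =1 S.
Proof.
move=> RS; have RSC F : R (fpsC F) = S (fpsC F).
  have [s ->] := at1_decomp F; rewrite fpsC_sum !linear_sum; apply: eq_bigr => u _.
  rewrite !fpsC_mul; have [_ RM] := fd_monoid_morphism R.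
  by have [_ SM] := fd_monoid_morphism S; rewrite !RM !SM !RS.
move=> F; apply: fpsP => n; rewrite !fd_series /fps_series; apply: eq_bigr => k _.
by rewrite /fd_coef RSC.
Qed.

Definition coslice (x : X) G : 'O(X) :=
  pullback (morphism_pair (morphism_cst X x) (@morphism_id K X)) G.

Lemma coslice_decomp x G (s : seq ('O(X) * 'O(X))) :
  (forall x y, G (x, y) = \sum_(u <- s) u.1 x * u.2 y) ->
  coslice x G = \sum_(u <- s) (u.1 x : K) *: u.2.
Proof. by move=> hs; apply: regfunP => y; rewrite regfun_sumE /= hs. Qed.

(** This is the chain rule for a function of [x_k] and [x_l]. It includes the case [k = l], which
    the diagonal fields [A_jj] and [B_ii] require. *)
Lemma vf_at2 (D : 'Vect(X3)) k l G w :
  D (at2 k l G) w =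
  D (at1 k (slice (pr l w) G)) w + D (at1 l (coslice (pr k w) G)) w.
Proof.
have [s [hs ->]] := at2_decomp k l G.
rewrite (sliceE _ hs) (coslice_decomp _ hs).
have at1_sum i (a : 'O(X) * 'O(X) -> K) (b : 'O(X) * 'O(X) -> 'O(X)) :
    D (at1 i (\sum_(u <- s) a u *: b u)) w = \sum_(u <- s) a u * D (at1 i (b u)) w.
  have -> : at1 i (\sum_(u <- s) a u *: b u) = \sum_(u <- s) a u *: at1 i (b u).
    by apply: regfunP => v; rewrite /= !regfun_sumE.
  by rewrite linear_sum regfun_sumE; apply: eq_bigr => u _; rewrite linearZ.
rewrite !at1_sum linear_sum regfun_sumE -big_split; apply: eq_bigr => u _ /=.
by rewrite vf_leibniz /= mulrC.
Qed.

End LegCoordinates.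

Definition leg_eq i j :=
  match i, j with
  | leg1, leg1 | leg2, leg2 | leg3, leg3 => true
  | _, _ => false
  end.

(** * The components of [r] as fields on X^3 *)

Section Components.
Variables (K : closedFieldType) (X : affVariety K).
Notation X2 := (aprod X X).
Notation X3 := (aprod (aprod X X) X).
Variable r : 'Vect(X2).
Implicit Types (i j k l : leg) (f g : 'O(X)) (F : 'O(X3)).

Definition rA f : 'O(X2) := r (pullback (@morphism_fst K X X) f).
Definition rB f : 'O(X2) := r (pullback (@morphism_snd K X X) f).

Lemma rA_leg_is_linear j i : linear (fun f => at2 i j (rA f)).
Proof.
move=> c f g; rewrite /rA /at2.
by rewrite pullback_is_linear linearP pullback_is_linear.
Qed.
Lemma rA_leg_leibniz j i f g :
  at2 i j (rA (f * g)) = at2 i j (rA f) * at1 i g + at1 i f * at2 i j (rA g).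
Proof.
rewrite /rA /at2 pullbackM vf_leibniz pullbackD !pullbackM.
have e h : pullback (morphism_pair (@morphism_pr _ _ i) (@morphism_pr _ _ j))
    (pullback (@morphism_fst K X X) h) = at1 i h by exact: regfunP.
by rewrite !e.
Qed.

Lemma rB_leg_is_linear j i : linear (fun f => at2 j i (rB f)).
Proof.
move=> c f g; rewrite /rB /at2.
by rewrite pullback_is_linear linearP pullback_is_linear.
Qed.
Lemma rB_leg_leibniz j i f g :
  at2 j i (rB (f * g)) = at2 j i (rB f) * at1 i g + at1 i f * at2 j i (rB g).
Proof.
rewrite /rB /at2 pullbackM vf_leibniz pullbackD !pullbackM.
have e h : pullback (morphism_pair (@morphism_pr _ _ j) (@morphism_pr _ _ i))
    (pullback (@morphism_snd K X X) h) = at1 i h by exact: regfunP.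
by rewrite !e.
Qed.

(* The first index is the parameter, the second one the coordinate that moves. *)
Definition vA j i : 'Vect(X3) := vf_leg (@rA_leg_is_linear j i) (@rA_leg_leibniz j i).
Definition vB j i : 'Vect(X3) := vf_leg (@rB_leg_is_linear j i) (@rB_leg_leibniz j i).

Lemma at1_upd i k f (w : X3) x : leg_eq i k = false -> at1 k f (upd i w x) = at1 k f w.
Proof. by case: i; case: k. Qed.

Lemma leg_eqP i k : reflect (i = k) (leg_eq i k).
Proof. by case: i; case: k; constructor. Qed.

Lemma vA_at1 j i k f : vA j i (at1 k f) = if leg_eq i k then at2 i j (rA f) else 0.
Proof.
case: leg_eqP => [<-|/leg_eqP/negbTE ik]; first exact: vf_leg_at1.
by apply: vf_leg_independent => w x; exact: at1_upd.
Qed.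

Lemma vB_at1 j i k f : vB j i (at1 k f) = if leg_eq i k then at2 j i (rB f) else 0.
Proof.
case: leg_eqP => [<-|/leg_eqP/negbTE ik]; first exact: vf_leg_at1.
by apply: vf_leg_independent => w x; exact: at1_upd.
Qed.

Lemma at2E i j (G : 'O(X2)) (w : X3) : at2 i j G w = G (pr i w, pr j w).
Proof. by []. Qed.

Lemma vf_addE (Y : affVariety K) (D E : 'Vect(Y)) (f : 'O(Y)) : vf_add D E f = D f + E f.
Proof. by []. Qed.
Lemma vf_oppE (Y : affVariety K) (D : 'Vect(Y)) (f : 'O(Y)) : vf_opp D f = - D f.
Proof. by []. Qed.

Lemma vf_cst (Y : affVariety K) (D : 'Vect(Y)) (f : 'O(Y)) (c : K) :
  (forall y, f y = c) -> D f = 0.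
Proof.
move=> fc; have D1 : D 1 = 0.
  by apply: (addrI (D 1)); rewrite addr0 -[in RHS](mulr1 1) vf_leibniz mulr1 mul1r.
have -> : f = c *: (1 : 'O(Y)).
  by apply: regfunP => y; rewrite fc; apply: esym; exact: mulr1.
by rewrite linearZ /= D1 scaler0.
Qed.

Lemma vf12E : vf12 r =1 vf_add (vA leg2 leg1) (vB leg1 leg2).
Proof.
apply: vf_ext => -[] f; rewrite vf_addE vA_at1 vB_at1 /leg_eq ?addr0 ?add0r;
  apply: regfunP => -[[x y] z]; rewrite ?at2E.
- exact: (@op12E _ _ r _ _ _ _ (pullback (@morphism_fst K X X) f)).
- exact: (@op12E _ _ r _ _ _ _ (pullback (@morphism_snd K X X) f)).
(* With z fixed, a function of the third coordinate is a constant on X^2, so [r] annihilates it. *)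
- rewrite (@op12E _ _ r _ _ _ _ (pullback (morphism_cst X2 z) f)) //.
  by rewrite (@vf_cst _ _ _ (f z)).
Qed.

Lemma vf13E : vf13 r =1 vf_add (vA leg3 leg1) (vB leg1 leg3).
Proof.
apply: vf_ext => -[] f; rewrite vf_addE vA_at1 vB_at1 /leg_eq ?addr0 ?add0r;
  apply: regfunP => -[[x y] z]; rewrite ?at2E.
- exact: (@op13E _ _ r _ _ _ _ (pullback (@morphism_fst K X X) f)).
- rewrite (@op13E _ _ r _ _ _ _ (pullback (morphism_cst X2 y) f)) //.
  by rewrite (@vf_cst _ _ _ (f y)).
- exact: (@op13E _ _ r _ _ _ _ (pullback (@morphism_snd K X X) f)).
Qed.

Lemma vf23E : vf23 r =1 vf_add (vA leg3 leg2) (vB leg2 leg3).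
Proof.
apply: vf_ext => -[] f; rewrite vf_addE vA_at1 vB_at1 /leg_eq ?addr0 ?add0r;
  apply: regfunP => -[[x y] z]; rewrite ?at2E.
- rewrite (@op23E _ _ r _ _ _ _ (pullback (morphism_cst X2 x) f)) //.
  by rewrite (@vf_cst _ _ _ (f x)).
- exact: (@op23E _ _ r _ _ _ _ (pullback (@morphism_fst K X X) f)).
- exact: (@op23E _ _ r _ _ _ _ (pullback (@morphism_snd K X X) f)).
Qed.

Definition legE := (vf_addE, vf_oppE, vA_at1, vB_at1, vf_at2, at2E).

(** The commutator of two derivations is a derivation, so it suffices that it vanishes on functions
    of one coordinate, which generate [O(X^3)]. *)
Lemma vf_comm_ext (D E : 'Vect(X3)) :
  (forall k f w, D (E (at1 k f)) w = E (D (at1 k f)) w) ->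
  forall F, D (E F) = E (D F).
Proof.
move=> DE; have DE1 k f : D (E (at1 k f)) = E (D (at1 k f)) by exact: regfunP.
have DEM F F' : D (E F) = E (D F) -> D (E F') = E (D F') ->
    D (E (F * F')) = E (D (F * F')).
  by rewrite !vf_leibniz !linearD /= !vf_leibniz => -> ->; ring.
move=> F; have [s ->] := at1_decomp F; rewrite !linear_sum; apply: eq_bigr => u _.
by apply: (DEM) => //; apply: DEM.
Qed.

Definition independent k F := forall (w : X3) x, F (upd k w x) = F w.
(** Such a [D] restricts to functions of the two coordinates other than [x_k]; a field as in [kills]
    moves at most [x_k]. *)
Definition keeps k (D : 'Vect(X3)) := forall F, independent k F -> independent k (D F).
Definition kills k (D : 'Vect(X3)) := forall F, independent k F -> D F = 0.

Lemma upd_upd i k (w : X3) x y : leg_eq i k = false ->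
  upd i (upd k w x) y = upd k (upd i w y) x.
Proof. by case: i; case: k. Qed.

Lemma pr_upd i k (w : X3) x : leg_eq i k = false -> pr i (upd k w x) = pr i w.
Proof. by case: i; case: k. Qed.

Lemma freeze_independent i k (w : X3) x F : leg_eq i k = false -> independent k F ->
  freeze i (upd k w x) F = freeze i w F.
Proof. by move=> ik kF; apply: regfunP => y; rewrite /= upd_upd // kF. Qed.

Lemma keeps_vA j i k : leg_eq i k = false -> leg_eq j k = false -> keeps k (vA j i).
Proof. by move=> ik jk F kF w x; rewrite /= freeze_independent // !pr_upd. Qed.

Lemma keeps_vB j i k : leg_eq i k = false -> leg_eq j k = false -> keeps k (vB j i).
Proof. by move=> ik jk F kF w x; rewrite /= freeze_independent // !pr_upd. Qed.

Lemma keeps_add k (D E : 'Vect(X3)) : keeps k D -> keeps k E -> keeps k (vf_add D E).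
Proof.
by move=> kD kE F kF w x; rewrite vf_addE !regfunE kD // kE.
Qed.

Lemma keeps_opp k (D : 'Vect(X3)) : keeps k D -> keeps k (vf_opp D).
Proof. by move=> kD F kF w x; rewrite vf_oppE !regfunE kD. Qed.

Lemma kills_vA j k : kills k (vA j k).
Proof. by move=> F kF; exact: vf_leg_independent. Qed.

Lemma kills_vB j k : kills k (vB j k).
Proof. by move=> F kF; exact: vf_leg_independent. Qed.

Lemma kills_opp k (D : 'Vect(X3)) : kills k D -> kills k (vf_opp D).
Proof. by move=> kD F kF; rewrite vf_oppE kD // oppr0. Qed.

End Components.

(* Shears and the abstract exchange relation *)
Local Infix "+v" := vf_add (at level 50, left associativity).
Local Notation "-v D" := (vf_opp D) (at level 35).
Local Notation comm D E := (forall F, D (E F) = E (D F)).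

Section Flows.
Variables (K : closedFieldType) (K0 : [pchar K] =i pred0) (X : affVariety K).
Notation X3 := (aprod (aprod X X) X).
Implicit Types (D E U V W : 'Vect(X3)) (F : fps 'O(X3)).

Lemma exph_fixes D (f : 'O(X3)) : D f = 0 -> exph D (fpsC f) = fpsC f.
Proof.
move=> Df; rewrite -[RHS](exph_zero K0).
apply: (@exph_eq_on _ _ (fun g => D g = 0)) => [v -> | // | [|n]]; rewrite ?linear0 //.
Qed.

Lemma exph_independent k D F : keeps k D ->
  (forall n, independent k (F n)) -> forall n, independent k (exph D F n).
Proof.
move=> kD; apply: exph_preserves => //.
- by move=> u v ku kv w x; rewrite !regfunE ku kv.
- by move=> a v kv w x; rewrite -[LHS]/(a * v _) -[RHS]/(a * v _) kv.
Qed.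

Lemma fpsC_independent k (f : 'O(X3)) : independent k f ->
  forall n, independent k (fpsC f n).
Proof. by move=> kf [|n]. Qed.

(* Both sides are ring automorphisms, so they are compared on functions of a
   single coordinate; these do not depend on [x_j] or do not depend on [x_k],
   and then [U] or [W] acts trivially. *)
Lemma shear j k D U W : leg_eq j k = false -> leg_eq k j = false ->
  keeps j D -> keeps j W -> kills j U -> keeps k D -> keeps k U -> kills k W ->
  (forall f, D (at1 j f) = 0) -> forall F,
  exph (D +v U) (exph (-v D) (exph (D +v W) F)) = exph (D +v U +v W) F.
Proof.
move=> jk kj jD jW jU kD kU kW Dj.
pose e D := fd_exp K0 D.
apply: (@fd_ext _ _ (fd_comp (e (D +v U)) (fd_comp (e (-v D)) (e (D +v W))))
  (e (D +v U +v W))) => m f.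
rewrite -[LHS]/(exph (D +v U) (exph (-v D) (exph (D +v W) (fpsC (at1 m f))))).
rewrite -[RHS]/(exph (D +v U +v W) (fpsC (at1 m f))).
have [|/leg_eqP mj] := boolP (leg_eq j m).
  case: leg_eqP => // <- _.
  have kf : independent k (at1 j f) by move=> w x; rewrite at1_upd.
  have Wf : W (at1 j f) = 0 by exact: kW.
  rewrite (exph_fixes (D := D +v W)) ?vf_addE ?Wf ?Dj ?addr0 //.
  rewrite (exph_fixes (D := -v D)) ?vf_oppE ?Dj ?oppr0 //.
  apply: (@exph_eq_on _ _ (independent k)); first exact: keeps_add.
    by move=> v kv; rewrite !vf_addE kW // addr0.
  exact: fpsC_independent.
have jf : independent j (at1 m f).
  by move=> w x; rewrite at1_upd //; case: leg_eqP mj.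
have jDW : keeps j (D +v W) by exact: keeps_add.
have jF := fpsC_independent jf.
have jG := exph_independent (keeps_opp jD) (exph_independent jDW jF).
have jU' : keeps j U by move=> g /jU->.
have DU g : independent j g -> (D +v U) g = D g by move=> jg; rewrite vf_addE jU // addr0.
rewrite (exph_eq_on (keeps_add jD jU') DU jG) exphNK //.
by apply: exph_eq_on jF => // g jg; rewrite !vf_addE jU // addr0.
Qed.

(** Both orders of [U] and [W] are recorded because equality of the two composites is what makes
    shears over the same [D] commute. *)
Definition shears D U W :=
  (forall F, exph (D +v U) (exph (-v D) (exph (D +v W) F)) = exph (D +v U +v W) F) /\
  (forall F, exph (D +v W) (exph (-v D) (exph (D +v U) F)) = exph (D +v U +v W) F).

Lemma shearsP j k D U W : leg_eq j k = false -> leg_eq k j = false ->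
  keeps j D -> keeps j W -> kills j U -> keeps k D -> keeps k U -> kills k W ->
  (forall f, D (at1 j f) = 0) -> (forall f, D (at1 k f) = 0) -> shears D U W.
Proof.
move=> jk kj jD jW jU kD kU kW Dj Dk; split=> F; first exact: (shear jk kj).
by rewrite (shear kj jk) //; apply: eq_exph => g; rewrite !vf_addE addrAC.
Qed.

(** [P_ij] is [shearR] of [B_ii] and [B_ij], and [L_ji] is [shearL] of [A_jj] and [A_ji]. *)
Definition shearR D U F := exph (D +v U) (exph (-v D) F).
Definition shearL D U F := exph (-v D) (exph (D +v U) F).

Lemma comm_opp D E : comm D E -> comm (-v D) E.
Proof. by move=> DE F; rewrite !vf_oppE linearN DE. Qed.

Lemma comm_sym D E : comm D E -> comm E D.
Proof. by move=> DE F; rewrite DE. Qed.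

(** On the right, [shears] merges the factors into the exponentials of [E + V1 + V2] and
    [D + U1 + U2]. These commute; splitting them again in the opposite order and moving the outer
    [e^(- h E)] and [e^(- h D)] inwards yields the left side. *)
Lemma exchange D U1 U2 E V1 V2 : shears D U1 U2 -> shears E V1 V2 ->
  comm (D +v U1 +v U2) (E +v V1 +v V2) -> comm (D +v U2) (E +v V1) ->
  comm D E -> comm E (D +v U1) -> comm D (E +v V2) ->
  forall F, shearR D U1 (shearL E V1 (shearR D U2 (shearL E V2 F))) =
    shearL E V2 (shearL E V1 (shearR D U2 (shearR D U1 F))).
Proof.
move=> [SU SU'] [SV SV'] cUV c21 cDE cEU cDV F; rewrite /shearR /shearL.
rewrite SU' SV' -(exph_comm K0 cUV) -SU -SV.
rewrite (exph_comm K0 (comm_opp cEU)) (exph_comm K0 c21).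
rewrite (exph_comm K0 (comm_sym (comm_opp cDV))).
by rewrite !(exph_comm K0 (comm_opp (comm_sym (comm_opp cDE)))).
Qed.

Lemma shearL_comm D U W : shears D U W ->
  forall F, shearL D U (shearL D W F) = shearL D W (shearL D U F).
Proof. by move=> [S S'] F; rewrite /shearL S S'. Qed.

Lemma shearR_comm D U W : shears D U W ->
  forall F, shearR D U (shearR D W F) = shearR D W (shearR D U F).
Proof. by move=> [S S'] F; rewrite /shearR S S'. Qed.

(** Inverting a left shear gives the right shear of the negated fields. Negation is required only
    pointwise, so that double negations are allowed. *)
Lemma shearLK D D' U U' : (forall f, D' f = - D f) -> (forall f, U' f = - U f) ->
  forall F, shearR D' U' (shearL D U F) = F.
Proof.
move=> DD' UU' F; rewrite /shearR /shearL (@eq_exph _ _ (-v D') D) => [|f]; last first.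
  by rewrite vf_oppE DD' opprK.
rewrite exphNK // -[RHS](exphK K0 (D +v U)); apply: eq_exph => f.
by rewrite vf_addE DD' UU' -opprD.
Qed.

Lemma shearRK D D' U U' : (forall f, D' f = - D f) -> (forall f, U' f = - U f) ->
  forall F, shearL D' U' (shearR D U F) = F.
Proof.
move=> DD' UU' F; rewrite /shearR /shearL (@eq_exph _ _ (D' +v U') (-v (D +v U))) => [|f].
  rewrite exphK // (@eq_exph _ _ (-v D') D) => [|f]; first exact: exphNK.
  by rewrite vf_oppE DD' opprK.
by rewrite vf_addE DD' UU' -opprD.
Qed.

Lemma comm_add D E U : comm D U -> comm E U -> comm (D +v E) U.
Proof. by move=> DU EU F; rewrite !vf_addE linearD DU EU. Qed.

(* Because [e^(D + U) = e^(D + E) e^(- E + U)] and [e^(D + E) = e^D e^E]. *)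
Lemma shearL_swap D E U : comm D E -> comm (D +v E) U ->
  forall F, shearL D U F = shearL (-v E) U F.
Proof.
move=> DE DEU F; rewrite /shearL.
rewrite (@exphD _ K0 _ (D +v U) (D +v E) (-v E +v U)).
- rewrite (@exphD _ K0 _ (D +v E) D E) // exphK //.
  by apply: eq_exph => f; rewrite !vf_oppE opprK.
- by move=> f; rewrite !vf_addE vf_oppE; ring.
- apply: comm_sym; apply: comm_add (comm_sym DEU); apply: comm_opp.
  by apply: comm_sym; apply: comm_add.
Qed.

(** Here [e^(h (D + E))] is split off on the right, as [e^(h E) e^(h D)], so that [e^(h D)] cancels
    against [e^(- h D)]. *)
Lemma shearR_swap D E U : comm D E -> comm (D +v E) U ->
  forall F, shearR D U F = shearR (-v E) U F.
Proof.
move=> DE DEU F; rewrite /shearR.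
have DES : comm (D +v E) (-v E +v U).
  apply: comm_sym; apply: comm_add (comm_sym DEU); apply: comm_opp.
  by apply: comm_sym; apply: comm_add.
rewrite (@exphD _ K0 _ (D +v U) (-v E +v U) (D +v E)); last exact: comm_sym.
- rewrite (@exphD _ K0 _ (D +v E) E D) ?exphNK //; last 1 first.
  + by move=> f; rewrite !vf_addE addrC.
  + by congr (exph _ _); apply: eq_exph => f; rewrite !vf_oppE opprK.
- by move=> f; rewrite !vf_addE vf_oppE; ring.
Qed.

End Flows.

(** * Commuting fields from the classical equation and the braid identity for shears *)

Section Braiding.
Variables (K : closedFieldType) (K0 : [pchar K] =i pred0) (X : affVariety K).
Notation X3 := (aprod (aprod X X) X).
Variables (r : 'Vect(aprod X X)) (r_cybe : classical_yang_baxter r).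
Notation A j i := (vA r j i).
Notation B j i := (vB r j i).
Notation "1" := leg1. Notation "2" := leg2. Notation "3" := leg3.

(** The arguments are the coordinates moved by the second and the third field of [shears]. *)
Ltac leg_shears j k :=
  apply: (@shearsP _ K0 _ j k) => // *;
  rewrite ?vA_at1 ?vB_at1 ?oppr0 //;
  by [exact: keeps_vA | exact: keeps_vB | exact: kills_vA | exact: kills_vB
     | apply: keeps_opp; exact: keeps_vA | apply: keeps_opp; exact: keeps_vB
     | apply: kills_opp; exact: kills_vA | apply: kills_opp; exact: kills_vB].

Lemma shears_B1 : shears (B 1 1) (B 1 2) (B 1 3).
Proof. leg_shears 2 3. Qed.
Lemma shears_B1' : shears (B 1 1) (B 1 3) (B 1 2).
Proof. leg_shears 3 2. Qed.
Lemma shears_A3 : shears (A 3 3) (A 3 1) (A 3 2).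
Proof. leg_shears 1 2. Qed.
Lemma shears_A3' : shears (A 3 3) (A 3 2) (A 3 1).
Proof. leg_shears 2 1. Qed.
(** In this lemma and the next the two shears over one base field are of different types; the
    negated field belongs to the inverse of [P_23], respectively of [L_21]. *)
Lemma shears_A2 : shears (A 2 2) (A 2 1) (-v B 2 3).
Proof. leg_shears 1 3. Qed.
Lemma shears_B2 : shears (B 2 2) (-v A 2 1) (B 2 3).
Proof. leg_shears 1 3. Qed.

Local Opaque vA vB vf_add vf_opp at1 at2 rA rB slice coslice.

Lemma cybe_component k (f : 'O(X)) x y z (D12 := A 2 1 +v B 1 2)
    (D13 := A 3 1 +v B 1 3) (D23 := A 3 2 +v B 2 3) (w : X3 := ((x, y), z)) :
  D12 (D13 (at1 k f)) w - D13 (D12 (at1 k f)) w +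
  (D12 (D23 (at1 k f)) w - D23 (D12 (at1 k f)) w) +
  (D13 (D23 (at1 k f)) w - D23 (D13 (at1 k f)) w) = 0.
Proof.
have := congr1 (fun F : 'O(X3) => F w) (r_cybe (at1 k f)).
by rewrite /lie !vf12E !vf13E !vf23E.
Qed.

Ltac leg_eval :=
  rewrite !legE /leg_eq; do ? [rewrite !(add0r, addr0, oppr0, linear0)];
  rewrite ?(linearD, linearN); do ? [rewrite !(legE, regfunE)] => /=.

(* The value of [rA r f] at [(x, z)] is [A_z f (x)] and that of [rB r f] at
   [(x, z)] is [B_x f (z)]. The component of the classical Yang-Baxter equation
   along [x_k] is solved for a composite that does not occur on its right-hand
   side, so that together the three components can be used for rewriting. *)
Lemma cybe1 (f : 'O(X)) x y z :
  rB r (coslice x (rA r f)) (y, z) = rA r (slice z (rA r f)) (x, y)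
    - rA r (slice y (rA r f)) (x, z) - rA r (coslice x (rA r f)) (y, z).
Proof.
have /= := cybe_component leg1 f x y z; rewrite !legE /leg_eq.
rewrite !(add0r, addr0, oppr0, linear0) !(legE, regfunE) /=.
by move=> h; rewrite -[RHS]subr0 -h; ring.
Qed.

Lemma cybe2 (f : 'O(X)) x y z :
  rB r (slice z (rA r f)) (x, y) = rA r (slice y (rB r f)) (x, z)
    + rA r (coslice x (rB r f)) (y, z) - rB r (coslice y (rA r f)) (x, z).
Proof.
have /= := cybe_component leg2 f x y z; rewrite !legE /leg_eq.
rewrite !(add0r, addr0, oppr0, linear0) !(legE, regfunE) /=.
by move=> h; rewrite -[RHS]addr0 -h; ring.
Qed.

Lemma cybe3 (f : 'O(X)) x y z :
  rA r (slice z (rB r f)) (x, y) = rB r (coslice x (rB r f)) (y, z)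
    - rB r (coslice y (rB r f)) (x, z) - rB r (slice z (rB r f)) (x, y).
Proof.
have /= := cybe_component leg3 f x y z; rewrite !legE /leg_eq.
rewrite !(add0r, addr0, oppr0, linear0) !(legE, regfunE) /=.
by move=> h; rewrite -[RHS]addr0 -h; ring.
Qed.

(** After evaluation on a function of one coordinate, the classical equation is used as a rewriting
    system. It holds at all triples of points, in particular at coinciding ones, which is how the
    diagonal fields are handled. *)
Ltac leg_comm :=
  apply: vf_comm_ext => -[] f [[x y] z]; leg_eval;
  do ? [rewrite !(cybe1, cybe2, cybe3)]; ring.

Lemma comm_B11_A33 : comm (B 1 1) (A 3 3).
Proof. leg_comm. Qed.
Lemma comm_B11_A22 : comm (B 1 1) (A 2 2).
Proof. leg_comm. Qed.
Lemma comm_B22_A33 : comm (B 2 2) (A 3 3).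
Proof. leg_comm. Qed.
(** Both fields move [x_2]; the identity is [cybe2] with all three points equal. *)
Lemma comm_A22_B22 : comm (A 2 2) (B 2 2).
Proof. leg_comm. Qed.
(** This relation and the next two split the middle exponential of the quantization in [shears_exp]
    and swap the two inner factors in [exchange]. *)
Lemma comm_12 : comm (B 1 1 +v B 1 2) (A 2 2 +v A 2 1).
Proof. leg_comm. Qed.
Lemma comm_13 : comm (B 1 1 +v B 1 3) (A 3 3 +v A 3 1).
Proof. leg_comm. Qed.
Lemma comm_23 : comm (B 2 2 +v B 2 3) (A 3 3 +v A 3 2).
Proof. leg_comm. Qed.

Lemma comm_123 : comm (B 1 1 +v B 1 2 +v B 1 3) (A 3 3 +v A 3 1 +v A 3 2).
Proof. leg_comm. Qed.
Lemma comm_132 : comm (B 1 1 +v B 1 3 +v B 1 2) (A 2 2 +v A 2 1 +v -v B 2 3).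
Proof. leg_comm. Qed.
Lemma comm_213 : comm (B 2 2 +v -v A 2 1 +v B 2 3) (A 3 3 +v A 3 2 +v A 3 1).
Proof. leg_comm. Qed.

Lemma comm_A33_B12 : comm (A 3 3) (B 1 1 +v B 1 2).
Proof. leg_comm. Qed.
Lemma comm_B11_A32 : comm (B 1 1) (A 3 3 +v A 3 2).
Proof. leg_comm. Qed.
Lemma comm_A22_B13 : comm (A 2 2) (B 1 1 +v B 1 3).
Proof. leg_comm. Qed.
Lemma comm_B11_B23 : comm (B 1 1) (A 2 2 +v -v B 2 3).
Proof. leg_comm. Qed.
Lemma comm_A33_A21 : comm (A 3 3) (B 2 2 +v -v A 2 1).
Proof. leg_comm. Qed.
Lemma comm_B22_A31 : comm (B 2 2) (A 3 3 +v A 3 1).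
Proof. leg_comm. Qed.
(** This allows the base field of [L_21] to be changed from [A_22] to [- B_22] by [shearL_swap]; the
    next lemma does the analogous thing for [P_23]. *)
Lemma comm_diag_A21 : comm (A 2 2 +v B 2 2) (A 2 1).
Proof. leg_comm. Qed.
Lemma comm_diag_B23 : comm (B 2 2 +v A 2 2) (B 2 3).
Proof. leg_comm. Qed.

Lemma yang_baxter_shears (L21 := shearL (A 2 2) (A 2 1)) (L31 := shearL (A 3 3) (A 3 1))
    (L32 := shearL (A 3 3) (A 3 2)) (P12 := shearR (B 1 1) (B 1 2))
    (P13 := shearR (B 1 1) (B 1 3)) (P23 := shearR (B 2 2) (B 2 3)) (F : fps 'O(X3)) :
  L21 (P12 (L31 (P13 (L32 (P23 F))))) = L32 (P23 (L31 (P13 (L21 (P12 F))))).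
Proof.
(* These are the inverses of [P23] and [L21], written over the other diagonal field: [Q23] shares
   its base with [L21], and [N21] with [P23], as [exchange] demands. *)
pose Q23 := shearL (A 2 2) (-v B 2 3); pose N21 := shearR (B 2 2) (-v A 2 1).
have PQ G : P23 (Q23 G) = G.
  rewrite /P23 (@shearR_swap _ K0 _ _ (A 2 2)); last exact: comm_diag_B23.
    by apply: (shearLK K0) => f; rewrite !vf_oppE ?opprK.
  exact: comm_sym comm_A22_B22.
have L21E G : L21 G = shearL (-v B 2 2) (A 2 1) G.
  exact: (shearL_swap K0 comm_A22_B22 comm_diag_A21).
have LN G : L21 (N21 G) = G.
  by rewrite L21E; apply: (shearRK K0) => f; rewrite !vf_oppE ?opprK.
have NL G : N21 (L21 G) = G.
  by rewrite L21E; apply: (shearLK K0) => f; rewrite !vf_oppE ?opprK.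
have II G : P12 (L31 (P13 (L32 G))) = L32 (L31 (P13 (P12 G))).
  exact: (exchange K0 shears_B1 shears_A3 comm_123 comm_13 comm_B11_A33 comm_A33_B12
    comm_B11_A32).
have I1 G : P13 (L21 (P12 (Q23 G))) = Q23 (L21 (P12 (P13 G))).
  exact: (exchange K0 shears_B1' shears_A2 comm_132 comm_12 comm_B11_A22 comm_A22_B13
    comm_B11_B23).
have I2 G : N21 (L32 (P23 (L31 G))) = L31 (L32 (P23 (N21 G))).
  exact: (exchange K0 shears_B2 shears_A3' comm_213 comm_23 comm_B22_A33 comm_A33_A21
    comm_B22_A31).
have QP G : Q23 (P23 G) = G.
  rewrite /P23 (@shearR_swap _ K0 _ _ (A 2 2)); last exact: comm_diag_B23.
    by apply: (shearRK K0) => f; rewrite !vf_oppE ?opprK.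
  exact: comm_sym comm_A22_B22.
have QL G : Q23 (L21 G) = L21 (Q23 G) by exact: esym (shearL_comm shears_A2 G).
have LL G : L32 (L31 G) = L31 (L32 G) by exact: esym (shearL_comm shears_A3 G).
have PP G : P13 (P12 G) = P12 (P13 G) by exact: esym (shearR_comm shears_B1 G).
(* The left side becomes [L21 L31 L32 P12 P13 P23 F]. The right side reaches the same form by
   inserting [Q23 P23] before [F] to apply [I1] and [L21 N21] in front to apply [I2], after which
   the inverses cancel. *)
by rewrite II LL PP -[in RHS](QP F) I1 QL -[RHS]LN I2 NL PQ.
Qed.

(** The field [E] is the sum of an A-part and a B-part; as these commute its exponential factors,
    and the outer exponentials complete the two shears. *)
Lemma shears_exp i j D (E : 'Vect(X3)) F :
  comm (B i i +v B i j) (A j j +v A j i) ->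
  (forall f, E f = A j j f + B i i f + D f) -> (forall f, D f = A j i f + B i j f) ->
  exph (-v A j j) (exph E (exph (-v B i i) F)) =
  shearL (A j j) (A j i) (shearR (B i i) (B i j) F).
Proof.
move=> c ED DE; rewrite /shearL /shearR.
have EE f : E f = (A j j +v A j i) f + (B i i +v B i j) f.
  by rewrite ED DE !vf_addE addrACA addrA.
by rewrite (exphD K0 EE (comm_sym c)).
Qed.

End Braiding.

(** * The diagonal fields on X and their copies on X^2 and X^3 *)

Section FactorFields.
Variables (K : closedFieldType) (X : affVariety K) (D : 'Vect(X)).
Notation X2 := (aprod X X).

Lemma vf_fst_leibniz (F G : 'O(X2)) :
  tensid D (F * G) = tensid D F * G + F * tensid D G.
Proof.
apply: regfunP => -[x y]; rewrite -[LHS]/(D (slice y (F * G)) x).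
have -> : slice y (F * G) = slice y F * slice y G by exact: regfunP.
by rewrite vf_leibniz.
Qed.
Definition vf_fst : 'Vect(X2) := VectorField vf_fst_leibniz.

Definition swap : X2 -> X2 := fun w => (w.2, w.1).
Lemma morphism_swap : morphism swap.
Proof. exact: morphism_pair (@morphism_snd K X X) (@morphism_fst K X X). Qed.

Definition vf_snd_map (F : 'O(X2)) : 'O(X2) :=
  pullback morphism_swap (tensid D (pullback morphism_swap F)).
Lemma vf_snd_is_linear : linear vf_snd_map.
Proof.
by move=> c F G; rewrite /vf_snd_map pullback_is_linear linearP pullback_is_linear.
Qed.
HB.instance Definition _ :=
  GRing.isLinear.Build K 'O(X2) 'O(X2) _ vf_snd_map vf_snd_is_linear.
Lemma vf_snd_leibniz (F G : 'O(X2)) :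
  vf_snd_map (F * G) = vf_snd_map F * G + F * vf_snd_map G.
Proof.
rewrite /vf_snd_map pullbackM vf_fst_leibniz pullbackD !pullbackM.
by congr (_ * _ + _ * _); apply: regfunP => -[].
Qed.
Definition vf_snd : 'Vect(X2) := VectorField vf_snd_leibniz.

End FactorFields.

Section Diagonal.
Variables (K : closedFieldType) (X : affVariety K) (r : 'Vect(aprod X X)).
Notation X2 := (aprod X X).
Notation X3 := (aprod (aprod X X) X).

Definition diag : X -> X2 := fun x => (x, x).
Lemma morphism_diag : morphism diag.
Proof. exact: morphism_pair (@morphism_id K X) (@morphism_id K X). Qed.

(** This is [A_x] evaluated at x itself, the parameter being the moving point; its copy in the j-th
    factor of X^3 is [A_jj]. *)
Definition diagA_map (f : 'O(X)) : 'O(X) := pullback morphism_diag (rA r f).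
Lemma diagA_is_linear : linear diagA_map.
Proof.
by move=> c f g; rewrite /diagA_map /rA pullback_is_linear linearP pullback_is_linear.
Qed.
HB.instance Definition _ :=
  GRing.isLinear.Build K 'O(X) 'O(X) _ diagA_map diagA_is_linear.
Lemma diagA_leibniz f g : diagA_map (f * g) = diagA_map f * g + f * diagA_map g.
Proof.
have e h : pullback morphism_diag (pullback (@morphism_fst K X X) h) = h.
  exact: regfunP.
by rewrite /diagA_map /rA pullbackM vf_leibniz pullbackD !pullbackM !e.
Qed.
Definition diagA : 'Vect(X) := VectorField diagA_leibniz.

Definition diagB_map (f : 'O(X)) : 'O(X) := pullback morphism_diag (rB r f).
Lemma diagB_is_linear : linear diagB_map.
Proof.
by move=> c f g; rewrite /diagB_map /rB pullback_is_linear linearP pullback_is_linear.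
Qed.
HB.instance Definition _ :=
  GRing.isLinear.Build K 'O(X) 'O(X) _ diagB_map diagB_is_linear.
Lemma diagB_leibniz f g : diagB_map (f * g) = diagB_map f * g + f * diagB_map g.
Proof.
have e h : pullback morphism_diag (pullback (@morphism_snd K X X) h) = h.
  exact: regfunP.
by rewrite /diagB_map /rB pullbackM vf_leibniz pullbackD !pullbackM !e.
Qed.
Definition diagB : 'Vect(X) := VectorField diagB_leibniz.

Lemma vf12_fst : vf12 (vf_fst diagB) =1 vB r leg1 leg1.
Proof.
move=> F; apply: regfunP => -[[x y] z]; rewrite -[LHS]/(rB r (slice y (slice z F)) (x, x)).
by congr (rB r _ _); apply: regfunP.
Qed.
Lemma vf13_fst : vf13 (vf_fst diagB) =1 vB r leg1 leg1.
Proof.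
move=> F; apply: regfunP => -[[x y] z].
rewrite -[LHS]/(rB r (slice z (slice y (pullback (@morphism_swap23 K X) F))) (x, x)).
by congr (rB r _ _); apply: regfunP.
Qed.
Lemma vf23_fst : vf23 (vf_fst diagB) =1 vB r leg2 leg2.
Proof.
move=> F; apply: regfunP => -[[x y] z].
rewrite -[LHS]/(rB r (slice z (slice x (pullback (@morphism_rotV K X) F))) (y, y)).
by congr (rB r _ _); apply: regfunP.
Qed.
Lemma vf12_snd : vf12 (vf_snd diagA) =1 vA r leg2 leg2.
Proof.
move=> F; apply: regfunP => -[[x y] z].
rewrite -[LHS]/(rA r (slice x (pullback (@morphism_swap K X) (slice z F))) (y, y)).
by congr (rA r _ _); apply: regfunP.
Qed.
Lemma vf13_snd : vf13 (vf_snd diagA) =1 vA r leg3 leg3.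
Proof.
move=> F; apply: regfunP => -[[x y] z].
rewrite -[LHS]/(rA r (slice x (pullback (@morphism_swap K X)
  (slice y (pullback (@morphism_swap23 K X) F)))) (z, z)).
by congr (rA r _ _); apply: regfunP.
Qed.
Lemma vf23_snd : vf23 (vf_snd diagA) =1 vA r leg3 leg3.
Proof.
move=> F; apply: regfunP => -[[x y] z].
rewrite -[LHS]/(rA r (slice y (pullback (@morphism_swap K X)
  (slice x (pullback (@morphism_rotV K X) F)))) (z, z)).
by congr (rA r _ _); apply: regfunP.
Qed.

End Diagonal.

Section LegsAdd.
Variables (K : closedFieldType) (X : affVariety K) (D E : 'Vect(aprod X X)).

Lemma vf12_add : vf12 (D +v E) =1 vf12 D +v vf12 E.
Proof.
move=> F; apply: regfunP => -[w z]; rewrite vf_addE regfun_add.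
by rewrite -[LHS]/((D +v E) (slice z F) w) vf_addE.
Qed.
Lemma vf13_add : vf13 (D +v E) =1 vf13 D +v vf13 E.
Proof.
move=> F; apply: regfunP => -[[x y] z]; rewrite vf_addE regfun_add.
rewrite -[LHS]/((D +v E) (slice y (pullback (@morphism_swap23 K X) F)) (x, z)).
by rewrite vf_addE.
Qed.
Lemma vf23_add : vf23 (D +v E) =1 vf23 D +v vf23 E.
Proof.
move=> F; apply: regfunP => -[[x y] z]; rewrite vf_addE regfun_add.
rewrite -[LHS]/((D +v E) (slice x (pullback (@morphism_rotV K X) F)) (y, z)).
by rewrite vf_addE.
Qed.
Lemma vf12_opp : vf12 (-v D) =1 -v vf12 D.
Proof. by move=> F; apply: regfunP. Qed.
Lemma vf13_opp : vf13 (-v D) =1 -v vf13 D.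
Proof. by move=> F; apply: regfunP. Qed.
Lemma vf23_opp : vf23 (-v D) =1 -v vf23 D.
Proof. by move=> F; apply: regfunP. Qed.

End LegsAdd.

HB.instance Definition _ (K : closedFieldType) (Y Z : affVariety K) (phi : Y -> Z)
    (h : morphism phi) :=
  GRing.isLinear.Build K 'O(Z) 'O(Y) _ (pullback h) (pullback_is_linear h).

(** * Legs of composites and of exponentials *)

Section DiffeoLegsExp.
Variables (K : closedFieldType) (K0 : [pchar K] =i pred0) (X : affVariety K).
Notation X2 := (aprod X X).
Notation X3 := (aprod (aprod X X) X).
Implicit Types (D : 'Vect(X2)) (R S : formalDiffeo X2) (F : fps 'O(X3)).

Lemma fd12_comp R S F : fd12 (fd_comp R S) F = fd12 R (fd12 S F).
Proof.
apply: fpsP => n; apply: regfunP => -[[x y] z].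
pose G : fps 'O(X2) := fps_map (slice z) F.
rewrite (@fd12E _ _ _ _ _ _ _ _ G) // (@fd12E _ _ _ _ _ _ _ _ (S G)) // => k x' y'.
by rewrite (@fd12E _ _ _ _ _ _ _ _ G).
Qed.

Lemma fd13_comp R S F : fd13 (fd_comp R S) F = fd13 R (fd13 S F).
Proof.
apply: fpsP => n; apply: regfunP => -[[x y] z].
pose G : fps 'O(X2) := fps_map (fun f => slice y (pullback (@morphism_swap23 K X) f)) F.
rewrite (@fd13E _ _ _ _ _ _ _ _ G) // (@fd13E _ _ _ _ _ _ _ _ (S G)) // => k x' y'.
by rewrite (@fd13E _ _ _ _ _ _ _ _ G).
Qed.

Lemma fd23_comp R S F : fd23 (fd_comp R S) F = fd23 R (fd23 S F).
Proof.
apply: fpsP => n; apply: regfunP => -[[x y] z].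
pose G : fps 'O(X2) := fps_map (fun f => slice x (pullback (@morphism_rotV K X) f)) F.
rewrite (@fd23E _ _ _ _ _ _ _ _ G) // (@fd23E _ _ _ _ _ _ _ _ (S G)) // => k x' y'.
by rewrite (@fd23E _ _ _ _ _ _ _ _ G).
Qed.

(** Restriction to a fixed third coordinate intertwines [vf12 D] with [D], hence also their
    exponentials. *)
Lemma fd12_exp D F : fd12 (fd_exp K0 D) F = exph (vf12 D) F.
Proof.
apply: fpsP => n; apply: regfunP => -[[x y] z].
rewrite (@fd12E _ _ _ _ _ _ _ _ (fps_map (slice z) F)) //.
rewrite -[RHS]/(fps_map (slice z) (exph (vf12 D) F) n (x, y)).
by rewrite (@exph_intertwine _ _ _ _ _ D) // => f; apply: regfunP => -[].
Qed.

Lemma fd13_exp D F : fd13 (fd_exp K0 D) F = exph (vf13 D) F.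
Proof.
apply: fpsP => n; apply: regfunP => -[[x y] z].
pose h := slice y \o pullback (@morphism_swap23 K X).
rewrite (@fd13E _ _ _ _ _ _ _ _ (fps_map h F)) //.
rewrite -[RHS]/(fps_map h (exph (vf13 D) F) n (x, z)).
by rewrite (@exph_intertwine _ _ _ _ _ D) // => f; apply: regfunP => -[].
Qed.

Lemma fd23_exp D F : fd23 (fd_exp K0 D) F = exph (vf23 D) F.
Proof.
apply: fpsP => n; apply: regfunP => -[[x y] z].
pose h := slice x \o pullback (@morphism_rotV K X).
rewrite (@fd23E _ _ _ _ _ _ _ _ (fps_map h F)) //.
rewrite -[RHS]/(fps_map h (exph (vf23 D) F) n (y, z)).
by rewrite (@exph_intertwine _ _ _ _ _ D) // => f; apply: regfunP => -[].
Qed.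

End DiffeoLegsExp.

(** * The quantization of [r] *)

Section Quantization.
Variables (K : closedFieldType) (K0 : [pchar K] =i pred0) (X : affVariety K).
Variables (r : 'Vect(aprod X X)) (r_cybe : classical_yang_baxter r).
Notation X3 := (aprod (aprod X X) X).

(** On X^2, [a] is [A_22] and the next field [b] is [B_11]. *)
Let a := vf_snd (diagA r).
Let b := vf_fst (diagB r).

Definition quantization : formalDiffeo (aprod X X) :=
  fd_comp (fd_exp K0 (-v a)) (fd_comp (fd_exp K0 (a +v b +v r)) (fd_exp K0 (-v b))).

Lemma quantization12 (F : fps 'O(X3)) : fd12 quantization F =
  shearL (vA r leg2 leg2) (vA r leg2 leg1)
    (shearR (vB r leg1 leg1) (vB r leg1 leg2) F).
Proof.
rewrite -(@shears_exp K K0 X r leg1 leg2 (vf12 r) (vf12 (a +v b +v r))).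
- rewrite !fd12_comp !fd12_exp (@eq_exph _ _ _ (-v vA r leg2 leg2)); last first.
    by move=> f; rewrite vf12_opp !vf_oppE vf12_snd.
  congr (exph _ (exph _ _)); apply: eq_exph => f.
  by rewrite vf12_opp !vf_oppE vf12_fst.
- exact: comm_12 r_cybe.
- by move=> f; rewrite !(vf12_add, vf_addE) vf12_snd vf12_fst.
- by move=> f; rewrite vf12E.
Qed.

Lemma quantization13 (F : fps 'O(X3)) : fd13 quantization F =
  shearL (vA r leg3 leg3) (vA r leg3 leg1)
    (shearR (vB r leg1 leg1) (vB r leg1 leg3) F).
Proof.
rewrite -(@shears_exp K K0 X r leg1 leg3 (vf13 r) (vf13 (a +v b +v r))).
- rewrite !fd13_comp !fd13_exp (@eq_exph _ _ _ (-v vA r leg3 leg3)); last first.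
    by move=> f; rewrite vf13_opp !vf_oppE vf13_snd.
  congr (exph _ (exph _ _)); apply: eq_exph => f.
  by rewrite vf13_opp !vf_oppE vf13_fst.
- exact: comm_13 r_cybe.
- by move=> f; rewrite !(vf13_add, vf_addE) vf13_snd vf13_fst.
- by move=> f; rewrite vf13E.
Qed.

Lemma quantization23 (F : fps 'O(X3)) : fd23 quantization F =
  shearL (vA r leg3 leg3) (vA r leg3 leg2)
    (shearR (vB r leg2 leg2) (vB r leg2 leg3) F).
Proof.
rewrite -(@shears_exp K K0 X r leg2 leg3 (vf23 r) (vf23 (a +v b +v r))).
- rewrite !fd23_comp !fd23_exp (@eq_exph _ _ _ (-v vA r leg3 leg3)); last first.
    by move=> f; rewrite vf23_opp !vf_oppE vf23_snd.
  congr (exph _ (exph _ _)); apply: eq_exph => f.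
  by rewrite vf23_opp !vf_oppE vf23_fst.
- exact: comm_23 r_cybe.
- by move=> f; rewrite !(vf23_add, vf_addE) vf23_snd vf23_fst.
- by move=> f; rewrite vf23E.
Qed.

Lemma quantization_yang_baxter : quantum_yang_baxter quantization.
Proof.
move=> F; rewrite !(quantization12, quantization13, quantization23).
exact: yang_baxter_shears.
Qed.

(** To first order the exponents add up, and [- a + (a + b + r) - b = r]. *)
Lemma quantization_first_order : first_order quantization r.
Proof.
have QE F : quantization F = exph (-v a) (exph (a +v b +v r) (exph (-v b) F)) by [].
have hE F n : ((hbar : fps K) *: fps_map r F) n.+1 = r (F n).
  by rewrite (hbarXE 1) /= subSS subn0.
move=> F [|[|//]] _; rewrite QE fps_add; first by rewrite !exph0 (hbarXE 1) addr0.
by rewrite hE !exph1 !exph0 !vf_oppE !vf_addE; ring.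
Qed.

End Quantization.

Theorem theorem1p1 (R : realType) (X : affVariety (complex R))
    (X_smooth : smooth X) (r : vectorField (aprod X X))
    (r_cybe : classical_yang_baxter r) :
  exists Rh : formalDiffeo (aprod X X),
    quantum_yang_baxter Rh /\ first_order Rh r.
Proof.
(* Characteristic zero makes the factorials in the exponential series invertible. *)
have K0 : [pchar complex R] =i pred0 := Num.Theory.pchar_num _.
exists (quantization K0 r); split; first exact: quantization_yang_baxter.
exact: quantization_first_order.
Qed.
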